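(* Let $(\mathcal C,\alpha)$ be a grading category with looper $\varepsilon$, and let $\mathcal M$ be a commutative submonoid of $\mathcal C$ (a commutative submonoid of $\mathrm{End}_{\mathcal C}(X)$ for some object $X$). If $A$ is a commutative $\mathcal M$-graded algebra, then $\mathsf{HH}_1(A)\cong\Omega^1_A$ as $\mathcal M$-graded $A$-modules.
   Context: Let $\Bbbk$ be a commutative unital ring with unit group $\Bbbk^\times$. A grading category $(\mathcal C,\alpha)$ is a small category with a function $\alpha$ from composable triples $(f_1,f_2,f_3)$ (so $f_3\circ f_2\circ f_1$ is defined) to $\Bbbk^\times$ satisfying $\alpha(f_1,f_2,f_3)\,\alpha(f_1,f_2,f_4\circ f_3)^{-1}\alpha(f_1,f_3\circ f_2,f_4)\,\alpha(f_2\circ f_1,f_3,f_4)^{-1}\alpha(f_2,f_3,f_4)=1$. A looper is a function $\varepsilon$ assigning to each pair $f:X\to Y$, $g:Y\to X$ an element of $\Bbbk^\times$ with $\varepsilon(f,g)^{-1}=\varepsilon(g,f)$ and, for every loop $h\circ g\circ f$ of length three, $\alpha(f,g,h)\varepsilon(f,h\circ g)\,\alpha(g,h,f)\varepsilon(g,f\circ h)\,\alpha(h,f,g)\varepsilon(h,g\circ f)=1$. Restrict $\alpha,\varepsilon$ to $\mathcal M$, with identity $\mathrm{Id}$; write $\mathcal L(\mathrm{Id},g)=\alpha(\mathrm{Id},\mathrm{Id},g)^{-1}$, $\mathcal R(g,\mathrm{Id})=\alpha(g,\mathrm{Id},\mathrm{Id})$. A commutative $\mathcal M$-graded algebra is a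 $\Bbbk$-module $A=\bigoplus_{g\in\mathcal M}A_g$ with $\Bbbk$-bilinear product $\mu$ and unit $1\in A_{\mathrm{Id}}$ such that for homogeneous elements $|\mu(x,y)|=|y|\circ|x|$, $\mu(\mu(x,y),z)=\alpha(|x|,|y|,|z|)\mu(x,\mu(y,z))$, $\mu(1,x)=\mathcal L(\mathrm{Id},|x|)x$, $\mu(x,1)=\mathcal R(|x|,\mathrm{Id})x$, and $\mu(x,y)=\varepsilon(|x|,|y|)\mu(y,x)$. $\mathsf{HH}_1(A)$ is the first homology of the Hochschild complex $A\otimes A\otimes A\xrightarrow{b_2}A\otimes A\xrightarrow{b_1}A$ with $b_1(a\otimes b)=\mu(a,b)-\varepsilon(|a|,|b|)\mu(b,a)$ (zero here) and $b_2(a\otimes b\otimes c)=\mu(a,b)\otimes c-\alpha(|a|,|b|,|c|)\,a\otimes\mu(b,c)+\varepsilon(|b|\circ|a|,|c|)\,\alpha(|c|,|a|,|b|)^{-1}\mu(c,a)\otimes b$; its $A$-module structure is $\rho_L(x,a\otimes b)=\alpha(|x|,|a|,|b|)^{-1}\mu(x,a)\otimes b$. An $\mathcal M$-graded (left) $A$-module $N$ satisfies $\rho_L(\mu(a,a'),n)=\alpha(|a|,|a'|,|n|)\rho_L(a,\rho_L(a',n))$ and $\rho_L(1,n)=\mathcal L(\mathrm{Id},|n|)n$. $\Omega^1_A$, the module of Kähler differentials, is the $\mathcal M$-graded $(A,A)$-bimodule (bimodule axioms with the associator $\alpha$: $\rho_R(\rho_R(n,b),b')=\alpha(|n|,|b|,|b'|)\rho_R(n,\mu(b,b'))$,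 $\rho_R(\rho_L(a,n),b)=\alpha(|a|,|n|,|b|)\rho_L(a,\rho_R(n,b))$, $\rho_R(n,1)=\mathcal R(|n|,\mathrm{Id})n$, and the left axioms above) generated by symbols $da$, $\Bbbk$-linear in $a$, with $|da|=|a|$ for homogeneous $a$, subject to $d\mu(a,b)=\rho_L(a,db)+\rho_R(da,b)$ and with left and right actions related by $\rho_R(\omega,b)=\varepsilon(|\omega|,|b|)\rho_L(b,\omega)$.
   Formalization: The formal theorem adds the hypothesis that the action ρ_L(x, a⊗b) maps the image of b_2 into itself, so that it does define an A-module structure on HH_1(A); this fails for some loopers, and the claim is then false or meaningless. *)

(* Defs.v *)
From HB Require Import structures.
From mathcomp Require Import all_boot all_order all_algebra generic_quotient.
From mathcomp Require Import boolp classical_sets.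
From mathcomp Require Import ring.

Set Implicit Arguments.
Unset Strict Implicit.
Unset Printing Implicit Defensive.

Import GRing.Theory.
Local Open Scope classical_set_scope.
Local Open Scope ring_scope.
Local Open Scope quotient_scope.

(* Units of a commutative ring that need be neither nontrivial nor equipped
   with a computable inverse (so comUnitRingType is not required). *)
Record unit_of (k : comPzRingType) := Unit {
  uval :> GRing.PzSemiRing.sort k;
  uinv : GRing.PzSemiRing.sort k;
  uvalK : uval * uinv = 1
}.

Record category := Category {
  obj : Type;
  hom : obj -> obj -> Type;
  idm : forall X, hom X X;
  comp : forall X Y Z, hom Y Z -> hom X Y -> hom X Z;
  comp_assoc : forall W X Y Z (h : hom Y Z) (g : hom X Y) (f : hom W X),
    comp h (comp g f) = comp (comp h g) f;
  comp_idl : forall X Y (f : hom X Y), comp (idm Y) f = f;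
  comp_idr : forall X Y (f : hom X Y), comp f (idm X) = f
}.

Arguments idm {c} X.

Reserved Notation "g \c f" (at level 40, left associativity).
Notation "g \c f" := (comp g f).

HB.instance Definition _ (C : category) (X Y : obj C) :=
  gen_eqMixin (hom X Y).
HB.instance Definition _ (C : category) (X Y : obj C) :=
  gen_choiceMixin (hom X Y).

Record grading_category (k : comPzRingType) := GradingCategory {
  gcat :> category;
  alpha : forall (W X Y Z : obj gcat),
    hom W X -> hom X Y -> hom Y Z -> unit_of k;
  alpha_cocycle : forall (V W X Y Z : obj gcat)
    (f1 : hom V W) (f2 : hom W X) (f3 : hom X Y) (f4 : hom Y Z),
    alpha f1 f2 f3 * uinv (alpha f1 f2 (f4 \c f3)) * alpha f1 (f3 \c f2) f4
      * uinv (alpha (f2 \c f1) f3 f4) * alpha f2 f3 f4 = 1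
}.

Record looper (k : comPzRingType) (C : grading_category k) := Looper {
  eps : forall (X Y : obj C), hom X Y -> hom Y X -> unit_of k;
  eps_inv : forall (X Y : obj C) (f : hom X Y) (g : hom Y X),
    uinv (eps f g) = eps g f;
  eps_loop : forall (X Y Z : obj C) (f : hom X Y) (g : hom Y Z) (h : hom Z X),
    alpha f g h * eps f (h \c g) * (alpha g h f * eps g (f \c h))
      * (alpha h f g * eps h (g \c f)) = 1
}.

Record comm_submonoid (C : category) (X : obj C) := CommSubmonoid {
  msupport : set (hom X X);
  msupport_id : msupport (idm X);
  msupport_comp : forall f g, msupport f -> msupport g -> msupport (g \c f);
  msupport_comm : forall f g, msupport f -> msupport g -> g \c f = f \c g
}.

Section Degrees.
Context {k : comPzRingType} {C : grading_category k} (e : looper C).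
Context {X : obj C} {M : comm_submonoid X}.

Definition deg : Type := set_type (msupport M).
HB.instance Definition _ := Choice.on deg.

Definition did : deg := exist _ (idm X) (mem_set (msupport_id M)).

Definition dcomp (g f : deg) : deg :=
  exist _ (\val g \c \val f)
    (mem_set (msupport_comp (set_mem (valP f)) (set_mem (valP g)))).

(* As for alpha, the arguments are listed in diagrammatic order. *)
Definition dalpha (f g h : deg) : unit_of k :=
  alpha (\val f) (\val g) (\val h).

Definition deps (f g : deg) : unit_of k := eps e (\val f) (\val g).

(* The unit constraints: lunit g is L(Id, g) and runit g is R(g, Id). *)
Definition lunit (g : deg) := uinv (dalpha did did g).

Definition runit (g : deg) := uval (dalpha g did did).

Lemma dcompA h g f : dcomp h (dcomp g f) = dcomp (dcomp h g) f.
Proof. by apply: val_inj; rewrite /= comp_assoc. Qed.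

Lemma dcompC g f : dcomp g f = dcomp f g.
Proof.
by apply: val_inj => /=; apply: msupport_comm; apply: set_mem; apply: valP.
Qed.

Lemma dcompidl f : dcomp did f = f.
Proof. by apply: val_inj; rewrite /= comp_idl. Qed.

Lemma dcompidr f : dcomp f did = f.
Proof. by apply: val_inj; rewrite /= comp_idr. Qed.

Lemma dalpha_cocycle f1 f2 f3 f4 :
  dalpha f1 f2 f3 * uinv (dalpha f1 f2 (dcomp f4 f3))
  * dalpha f1 (dcomp f3 f2) f4 * uinv (dalpha (dcomp f2 f1) f3 f4)
  * dalpha f2 f3 f4 = 1.
Proof. exact: alpha_cocycle. Qed.

Lemma deps_inv f g : uinv (deps f g) = deps g f.
Proof. exact: eps_inv. Qed.

Lemma deps_loop f g h :
  dalpha f g h * deps f (dcomp h g) * (dalpha g h f * deps g (dcomp f h))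
  * (dalpha h f g * deps h (dcomp g f)) = 1.
Proof. exact: eps_loop. Qed.

End Degrees.

Arguments deg {k C X} M.
Arguments did {k C X M}.

(* Internal direct sum decompositions: V is the direct sum of the submodules
   homog V g. *)
Record graded_module (k : comPzRingType) (D : choiceType) := GradedModule {
  gm_sort :> lmodType k;
  homog : D -> set gm_sort;
  homog0 : forall g, homog g 0;
  homogP : forall g (c : k) x y,
    homog g x -> homog g y -> homog g (c *: x + y);
  homog_span : forall x, exists (s : seq D) (y : D -> gm_sort),
    [/\ uniq s, forall g, homog g (y g) & x = \sum_(g <- s) y g];
  homog_indep : forall (s : seq D) (y : D -> gm_sort),
    uniq s -> (forall g, homog g (y g)) -> \sum_(g <- s) y g = 0 ->
    forall g, g \in s -> y g = 0
}.

Section LinearFacts.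
Variables (k : comPzRingType) (U V : lmodType k).

Lemma lin_0 (f : U -> V) : linear f -> f 0 = 0.
Proof.
move=> fl; have := fl (-1) 0 0.
by rewrite scaler0 addr0 scaleN1r addNr.
Qed.

Lemma lin_D (f : U -> V) : linear f -> forall x y, f (x + y) = f x + f y.
Proof. by move=> fl x y; rewrite -[x in LHS]scale1r fl scale1r. Qed.

Lemma lin_Z (f : U -> V) : linear f -> forall c x, f (c *: x) = c *: f x.
Proof. by move=> fl c x; rewrite -[c *: x]addr0 fl (lin_0 fl) addr0. Qed.

Lemma lin_sum (f : U -> V) : linear f ->
  forall (I : Type) (s : seq I) (F : I -> U),
  f (\sum_(i <- s) F i) = \sum_(i <- s) f (F i).
Proof.
move=> fl I s F; elim: s => [|i s IH]; first by rewrite !big_nil lin_0.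
by rewrite !big_cons lin_D // IH.
Qed.

End LinearFacts.

Section Spanned.
Variables (k : comPzRingType) (D : choiceType) (V : lmodType k).
Variable H : D -> set V.
Hypothesis H0 : forall g, H g 0.
Hypothesis HP : forall g (c : k) x y, H g x -> H g y -> H g (c *: x + y).

Lemma sum_uniq_sub (s s' : seq D) (F : D -> V) :
  uniq s -> uniq s' -> {subset s <= s'} ->
  \sum_(g <- s') (if g \in s then F g else 0) = \sum_(g <- s) F g.
Proof.
move=> us us' sub; rewrite -big_mkcond -big_filter; apply: perm_big.
apply: uniq_perm; rewrite ?filter_uniq // => g; rewrite mem_filter.
by case: (boolP (g \in s)) => //= /sub ->.
Qed.

Definition spanned (x : V) : Prop := exists (s : seq D) (y : D -> V),
  [/\ uniq s, forall g, H g (y g) & x = \sum_(g <- s) y g].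

Lemma spanned0 : spanned 0.
Proof. by exists [::], (fun=> 0); split=> //; rewrite big_nil. Qed.

Lemma spannedD x y : spanned x -> spanned y -> spanned (x + y).
Proof.
move=> [s [a [us ha ->]]] [s' [b [us' hb ->]]]; exists (undup (s ++ s')).
exists (fun g => (if g \in s then a g else 0) + (if g \in s' then b g else 0)).
split; first exact: undup_uniq.
  move=> g; rewrite -[X in X + _]scale1r; apply: HP; case: ifP => //.
rewrite big_split /= !sum_uniq_sub ?undup_uniq // => g gs;
by rewrite mem_undup mem_cat gs ?orbT.
Qed.

Lemma spannedZ c x : spanned x -> spanned (c *: x).
Proof.
move=> [s [a [us ha ->]]]; exists s, (fun g => c *: a g); split=> //.
  by move=> g; rewrite -[_ *: _]addr0; apply: HP.
by rewrite scaler_sumr.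
Qed.

Lemma spanned_homog g x : H g x -> spanned x.
Proof.
move=> hx; exists [:: g], (fun h => if h == g then x else 0).
split=> //; last by rewrite big_seq1 eqxx.
by move=> h; case: ifP => [/eqP ->|].
Qed.

Lemma spanned_ind (P : V -> Prop) :
  P 0 -> (forall x y, P x -> P y -> P (x + y)) ->
  (forall g x, H g x -> P x) -> forall x, spanned x -> P x.
Proof.
move=> P0 PD Ph x [s [y [_ hy ->]]].
elim: s => [|g s IH]; first by rewrite big_nil.
by rewrite big_cons; apply: PD => //; apply: Ph (hy g).
Qed.

End Spanned.

Section GradedTheory.
Variables (k : comPzRingType) (D : choiceType).

Variable V : graded_module k D.

Lemma homogD g (x y : V) : homog g x -> homog g y -> homog g (x + y).
Proof. by move=> hx hy; rewrite -[x]scale1r; apply: homogP. Qed.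

Lemma homogZ g c (x : V) : homog g x -> homog g (c *: x).
Proof. by move=> hx; rewrite -[c *: x]addr0; apply: homogP => //; apply: homog0. Qed.

Lemma decomposition_ex (x : V) : exists sy : seq D * (D -> V),
  [/\ uniq sy.1, forall g, homog g (sy.2 g) & x = \sum_(g <- sy.1) sy.2 g].
Proof. by have [s [y h]] := homog_span x; exists (s, y). Qed.

Definition decomposition (x : V) := cid (decomposition_ex x).

Definition supp (x : V) : seq D := (sval (decomposition x)).1.

Definition component (g : D) (x : V) : V :=
  if g \in supp x then (sval (decomposition x)).2 g else 0.

Lemma supp_uniq x : uniq (supp x).
Proof. by rewrite /supp; case: (decomposition x) => sy /= []. Qed.

Lemma component_homog g x : homog g (component g x).
Proof.
rewrite /component; case: ifP => _; last exact: homog0.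
by case: (decomposition x) => sy /= [].
Qed.

Lemma component_notin g x : g \notin supp x -> component g x = 0.
Proof. by rewrite /component => /negbTE ->. Qed.

Lemma sum_component x : x = \sum_(g <- supp x) component g x.
Proof.
transitivity (\sum_(g <- supp x) (sval (decomposition x)).2 g); last first.
  by apply: eq_big_seq => g gs; rewrite /component gs.
by rewrite /supp; case: (decomposition x) => sy /= [].
Qed.

Lemma component_uniq x (s : seq D) (y : D -> V) :
  uniq s -> (forall g, homog g (y g)) -> x = \sum_(g <- s) y g ->
  forall g, component g x = if g \in s then y g else 0.
Proof.
move=> us hy xE g; pose s' := undup (supp x ++ s).
pose z h : V := -1 *: (if h \in s then y h else 0) + component h x.
have hz h : homog h (z h).
  apply: homogP; last exact: component_homog.
  by case: ifP => _; [apply: hy | apply: homog0].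
have us' : uniq s' by apply: undup_uniq.
have z0 : \sum_(h <- s') z h = 0.
  rewrite big_split /= -scaler_sumr sum_uniq_sub //; last first.
    by move=> h hs; rewrite mem_undup mem_cat hs orbT.
  rewrite -xE.
  have -> : \sum_(h <- s') component h x =
            \sum_(h <- s') (if h \in supp x then component h x else 0).
    apply: eq_bigr => h _; case: ifP => // /negbT; exact: component_notin.
  rewrite sum_uniq_sub ?supp_uniq //; last first.
    by move=> h hs; rewrite mem_undup mem_cat hs.
  by rewrite -sum_component scaleN1r addNr.
have [gs'|gs'] := boolP (g \in s').
  have := homog_indep us' hz z0 gs'; rewrite /z scaleN1r => /eqP.
  by rewrite addrC subr_eq0 => /eqP.
move: gs'; rewrite mem_undup mem_cat negb_or => /andP [g1 g2].
by rewrite (negbTE g2) component_notin.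
Qed.

Lemma component_linear g : linear (component g).
Proof.
move=> c x y; pose s := undup (supp x ++ supp y).
have us : uniq s by apply: undup_uniq.
rewrite (@component_uniq _ s (fun g => c *: component g x + component g y)) //.
- case: ifP => // /negbT; rewrite mem_undup mem_cat negb_or => /andP [h1 h2].
  by rewrite !component_notin // scaler0 addr0.
- by move=> h; apply: homogP; apply: component_homog.
rewrite big_split /= -scaler_sumr; congr (_ *: _ + _).
  rewrite {1}[x]sum_component -(sum_uniq_sub _ (supp_uniq x) us).
    apply: eq_bigr => h _; case: ifP => // /negbT h1.
    by rewrite component_notin.
  by move=> h hs; rewrite mem_undup mem_cat hs.
rewrite {1}[y]sum_component -(sum_uniq_sub _ (supp_uniq y) us).
  apply: eq_bigr => h _; case: ifP => // /negbT h1.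
  by rewrite component_notin.
by move=> h hs; rewrite mem_undup mem_cat hs orbT.
Qed.

Lemma component_homogE g h x :
  homog g x -> component h x = if h == g then x else 0.
Proof.
move=> hx; rewrite (@component_uniq x [:: g] (fun h => if h == g then x else 0)) //.
- by rewrite mem_seq1; case: (h == g).
- by move=> i; case: ifP => [/eqP ->|_] //; apply: homog0.
by rewrite big_seq1 eqxx.
Qed.

Lemma homog_ind (P : V -> Prop) :
  P 0 -> (forall x y, P x -> P y -> P (x + y)) ->
  (forall g x, homog g x -> P x) -> forall x, P x.
Proof.
move=> P0 PD Ph x; rewrite [x]sum_component.
elim: (supp x) => [|g s IH]; first by rewrite big_nil.
by rewrite big_cons; apply: PD => //; apply: Ph (component_homog g x).
Qed.

(* Additive extension to V of a family of maps prescribed on the homogeneous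
   elements, F g being relevant only on homog V g. *)
Definition hext (W : lmodType k) (F : D -> V -> W) (x : V) : W :=
  \sum_(g <- supp x) F g (component g x).

Section Hext.
Variables (W : lmodType k) (F : D -> V -> W).
Hypothesis Fl : forall g, linear (F g).

Lemma hext_sup x (s : seq D) : uniq s -> {subset supp x <= s} ->
  hext F x = \sum_(g <- s) F g (component g x).
Proof.
move=> us sub; rewrite /hext -(sum_uniq_sub _ (supp_uniq x) us sub).
apply: eq_bigr => g _; case: ifP => // /negbT h.
by rewrite component_notin // lin_0.
Qed.

Lemma hext_linear : linear (hext F).
Proof.
move=> c x y; pose s := undup (supp x ++ supp y ++ supp (c *: x + y)).
have us : uniq s by apply: undup_uniq.
rewrite !(@hext_sup _ s) //.
- rewrite scaler_sumr -big_split; apply: eq_bigr => g _ /=.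
  by rewrite component_linear Fl.
- by move=> h hs; rewrite mem_undup !mem_cat hs !orbT.
- by move=> h hs; rewrite mem_undup !mem_cat hs.
- by move=> h hs; rewrite mem_undup !mem_cat hs !orbT.
Qed.

Lemma hext_homog g x : homog g x -> hext F x = F g x.
Proof.
move=> hx; pose s := undup (g :: supp x).
have us : uniq s by apply: undup_uniq.
rewrite (@hext_sup _ s) //; last first.
  by move=> h hs; rewrite mem_undup in_cons hs orbT.
rewrite (eq_bigr (fun h => if h \in [:: g] then F h x else 0)).
  rewrite sum_uniq_sub ?big_seq1 // => h.
  by rewrite mem_seq1 mem_undup in_cons => ->.
move=> h _; rewrite (component_homogE h hx) mem_seq1.
by case: ifP => // _; rewrite lin_0.
Qed.

End Hext.
End GradedTheory.


Section HextMany.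
Variables (k : comPzRingType) (D : choiceType) (U V W : graded_module k D).
Variable T : lmodType k.

Definition hext2 (F : D -> D -> U -> V -> T) (x : U) (y : V) : T :=
  hext (fun f x' => hext (fun g y' => F f g x' y') y) x.

Definition hext3 (F : D -> D -> D -> U -> V -> W -> T)
    (x : U) (y : V) (z : W) : T :=
  hext (fun f x' => hext (fun g y' => hext (fun h z' => F f g h x' y' z') z) y) x.

End HextMany.

(* Quotient of a k-module given up to an equivalence compatible with the
   operations; opposite is scaling by -1. *)
Record mod_setoid (k : comPzRingType) := ModSetoid {
  ms_sort :> Type;
  ms_eq : ms_sort -> ms_sort -> Prop;
  ms_zero : ms_sort;
  ms_add : ms_sort -> ms_sort -> ms_sort;
  ms_scale : k -> ms_sort -> ms_sort;
  ms_refl : forall x, ms_eq x x;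
  ms_sym : forall x y, ms_eq x y -> ms_eq y x;
  ms_trans : forall x y z, ms_eq x y -> ms_eq y z -> ms_eq x z;
  ms_addP : forall x x' y y',
    ms_eq x x' -> ms_eq y y' -> ms_eq (ms_add x y) (ms_add x' y');
  ms_scaleP : forall c x x', ms_eq x x' -> ms_eq (ms_scale c x) (ms_scale c x');
  ms_addA : forall x y z,
    ms_eq (ms_add x (ms_add y z)) (ms_add (ms_add x y) z);
  ms_addC : forall x y, ms_eq (ms_add x y) (ms_add y x);
  ms_add0 : forall x, ms_eq (ms_add ms_zero x) x;
  ms_addN : forall x, ms_eq (ms_add (ms_scale (-1) x) x) ms_zero;
  ms_scaleA : forall a b x,
    ms_eq (ms_scale a (ms_scale b x)) (ms_scale (a * b) x);
  ms_scale1 : forall x, ms_eq (ms_scale 1 x) x;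
  ms_scaleDr : forall a x y,
    ms_eq (ms_scale a (ms_add x y)) (ms_add (ms_scale a x) (ms_scale a y));
  ms_scaleDl : forall x a b,
    ms_eq (ms_scale (a + b) x) (ms_add (ms_scale a x) (ms_scale b x))
}.

Section MsQuot.
Variables (k : comPzRingType) (S : mod_setoid k).

Definition ms_rel : rel {classic S} := fun x y => `[< ms_eq (x : S) (y : S) >].

Lemma ms_rel_refl : reflexive ms_rel.
Proof. by move=> x; apply/asboolP/ms_refl. Qed.

Lemma ms_rel_sym : symmetric ms_rel.
Proof. by move=> x y; apply/asboolP/asboolP => /ms_sym. Qed.

Lemma ms_rel_trans : transitive ms_rel.
Proof. by move=> y x z /asboolP xy /asboolP yz; apply/asboolP/(ms_trans xy yz). Qed.

Canonical ms_equiv := EquivRel ms_rel ms_rel_refl ms_rel_sym ms_rel_trans.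

Definition ms_quot := {eq_quot ms_equiv}.
HB.instance Definition _ := Choice.on ms_quot.

Definition ms_class (x : S) : ms_quot := \pi_{eq_quot ms_equiv} (x : {classic S}).
Definition ms_repr (z : ms_quot) : S := repr (z : {eq_quot ms_equiv}).

Lemma ms_reprK z : ms_class (ms_repr z) = z.
Proof. exact: reprK. Qed.

Lemma ms_classP x y : ms_class x = ms_class y <-> ms_eq x y.
Proof.
by split=> [/eqmodP /asboolP|h] //; apply/eqmodP/asboolP.
Qed.

Lemma ms_repr_class x : ms_eq (ms_repr (ms_class x)) x.
Proof. by apply/ms_classP; rewrite ms_reprK. Qed.

Definition msq_add (x y : ms_quot) : ms_quot :=
  ms_class (ms_add (ms_repr x) (ms_repr y)).
Definition msq_scale (c : k) (x : ms_quot) : ms_quot :=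
  ms_class (ms_scale c (ms_repr x)).

Lemma msq_addE x y : msq_add (ms_class x) (ms_class y) = ms_class (ms_add x y).
Proof. by apply/ms_classP/ms_addP; apply: ms_repr_class. Qed.

Lemma msq_scaleE c x : msq_scale c (ms_class x) = ms_class (ms_scale c x).
Proof. by apply/ms_classP/ms_scaleP; apply: ms_repr_class. Qed.

Lemma ms_quotP (P : ms_quot -> Prop) : (forall x, P (ms_class x)) -> forall z, P z.
Proof. by move=> h z; rewrite -[z]ms_reprK. Qed.

Lemma msq_addA : associative msq_add.
Proof.
elim/ms_quotP=> x; elim/ms_quotP=> y; elim/ms_quotP=> z.
by rewrite !msq_addE; apply/ms_classP/ms_addA.
Qed.

Lemma msq_addC : commutative msq_add.
Proof.
elim/ms_quotP=> x; elim/ms_quotP=> y.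
by rewrite !msq_addE; apply/ms_classP/ms_addC.
Qed.

Lemma msq_add0 : left_id (ms_class (ms_zero S)) msq_add.
Proof. by elim/ms_quotP=> x; rewrite !msq_addE; apply/ms_classP/ms_add0. Qed.

Lemma msq_addN : left_inverse (ms_class (ms_zero S)) (msq_scale (-1)) msq_add.
Proof.
by elim/ms_quotP=> x; rewrite msq_scaleE !msq_addE; apply/ms_classP/ms_addN.
Qed.

HB.instance Definition _ :=
  GRing.isZmodule.Build ms_quot msq_addA msq_addC msq_add0 msq_addN.

Lemma msq_scaleA a b x : msq_scale a (msq_scale b x) = msq_scale (a * b) x.
Proof.
by elim/ms_quotP: x => x; rewrite !msq_scaleE; apply/ms_classP/ms_scaleA.
Qed.

Lemma msq_scale1 : left_id 1 msq_scale.
Proof. by elim/ms_quotP=> x; rewrite !msq_scaleE; apply/ms_classP/ms_scale1. Qed.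

Lemma msq_scaleDr : right_distributive msq_scale +%R.
Proof.
move=> a; elim/ms_quotP=> x; elim/ms_quotP=> y.
change (msq_scale a (msq_add (ms_class x) (ms_class y)) =
  msq_add (msq_scale a (ms_class x)) (msq_scale a (ms_class y))).
rewrite msq_addE !msq_scaleE msq_addE; exact/ms_classP/ms_scaleDr.
Qed.

Lemma msq_scaleDl v : {morph msq_scale^~ v : a b / a + b}.
Proof.
move=> a b; elim/ms_quotP: v => x /=.
change (msq_scale (a + b) (ms_class x) =
  msq_add (msq_scale a (ms_class x)) (msq_scale b (ms_class x))).
rewrite !msq_scaleE !msq_addE.
exact/ms_classP/ms_scaleDl.
Qed.

HB.instance Definition _ := GRing.Zmodule_isLmodule.Build k ms_quot
  msq_scaleA msq_scale1 msq_scaleDr msq_scaleDl.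

Lemma ms_classD x y : ms_class (ms_add x y) = ms_class x + ms_class y.
Proof. by rewrite [RHS]msq_addE. Qed.

Lemma ms_classZ c x : ms_class (ms_scale c x) = c *: ms_class x.
Proof. by rewrite [RHS]msq_scaleE. Qed.

Lemma ms_class0 : ms_class (ms_zero S) = 0.
Proof. by []. Qed.

End MsQuot.

Section TensorProduct.
Variables (k : comPzRingType) (V W : lmodType k).

Inductive tens_expr :=
| te_zero
| te_add of tens_expr & tens_expr
| te_scale of k & tens_expr
| te_pure of V & W.

Inductive tens_eq : tens_expr -> tens_expr -> Prop :=
| te_refl x : tens_eq x x
| te_sym x y : tens_eq x y -> tens_eq y x
| te_trans x y z : tens_eq x y -> tens_eq y z -> tens_eq x z
| te_addP x x' y y' :
    tens_eq x x' -> tens_eq y y' -> tens_eq (te_add x y) (te_add x' y')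
| te_scaleP c x x' : tens_eq x x' -> tens_eq (te_scale c x) (te_scale c x')
| te_addA x y z : tens_eq (te_add x (te_add y z)) (te_add (te_add x y) z)
| te_addC x y : tens_eq (te_add x y) (te_add y x)
| te_add0 x : tens_eq (te_add te_zero x) x
| te_addN x : tens_eq (te_add (te_scale (-1) x) x) te_zero
| te_scaleA a b x : tens_eq (te_scale a (te_scale b x)) (te_scale (a * b) x)
| te_scale1 x : tens_eq (te_scale 1 x) x
| te_scaleDr a x y :
    tens_eq (te_scale a (te_add x y)) (te_add (te_scale a x) (te_scale a y))
| te_scaleDl x a b :
    tens_eq (te_scale (a + b) x) (te_add (te_scale a x) (te_scale b x))
| te_pureDl v v' w :
    tens_eq (te_pure (v + v') w) (te_add (te_pure v w) (te_pure v' w))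
| te_pureDr v w w' :
    tens_eq (te_pure v (w + w')) (te_add (te_pure v w) (te_pure v w'))
| te_pureZl c v w : tens_eq (te_pure (c *: v) w) (te_scale c (te_pure v w))
| te_pureZr c v w : tens_eq (te_pure v (c *: w)) (te_scale c (te_pure v w)).

Definition tens_setoid : mod_setoid k :=
  ModSetoid te_refl te_sym te_trans te_addP te_scaleP te_addA te_addC te_add0
    te_addN te_scaleA te_scale1 te_scaleDr te_scaleDl.

Definition tens : lmodType k := ms_quot tens_setoid.

Definition pure (v : V) (w : W) : tens := @ms_class k tens_setoid (te_pure v w).

Lemma pure_linear_l w : linear (pure^~ w).
Proof.
move=> c v v'; rewrite /pure /= -ms_classZ -ms_classD; apply/ms_classP.
apply: te_trans (te_pureDl _ _ _) _; apply: te_addP (te_refl _).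
exact: te_pureZl.
Qed.

Lemma pure_linear_r v : linear (pure v).
Proof.
move=> c w w'; rewrite /pure /= -ms_classZ -ms_classD; apply/ms_classP.
apply: te_trans (te_pureDr _ _ _) _; apply: te_addP (te_refl _).
exact: te_pureZr.
Qed.

Lemma tens_ind (P : tens -> Prop) :
  P 0 -> (forall x y, P x -> P y -> P (x + y)) ->
  (forall c x, P x -> P (c *: x)) -> (forall v w, P (pure v w)) ->
  forall t, P t.
Proof.
move=> P0 PD PZ Pp; apply: ms_quotP; elim=> [|x IHx y IHy|c x IH|v w] //.
- rewrite ms_classD; exact: PD.
- rewrite ms_classZ; exact: PZ.
- exact: Pp.
Qed.

Variable U : lmodType k.

Definition bilin (b : V -> W -> U) : Prop :=
  (forall w, linear (b^~ w)) /\ (forall v, linear (b v)).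

Fixpoint tens_eval (b : V -> W -> U) (x : tens_expr) : U :=
  match x with
  | te_zero => 0
  | te_add x y => tens_eval b x + tens_eval b y
  | te_scale c x => c *: tens_eval b x
  | te_pure v w => b v w
  end.

(* The junk value 0 is only taken when b is not bilinear. *)
Definition tens_lift (b : V -> W -> U) (t : tens) : U :=
  if `[< bilin b >] then tens_eval b (ms_repr t) else 0.

Lemma tens_eval_eq b x y : bilin b -> tens_eq x y -> tens_eval b x = tens_eval b y.
Proof.
case=> bl br; elim=> {x y} //=.
- by move=> x y z _ -> _ ->.
- by move=> x x' y y' _ -> _ ->.
- by move=> c x x' _ ->.
- by move=> x y z; rewrite addrA.
- by move=> x y; rewrite addrC.
- by move=> x; rewrite add0r.
- by move=> x; rewrite scaleN1r addNr.
- by move=> a c x; rewrite scalerA.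
- by move=> x; rewrite scale1r.
- by move=> a x y; rewrite scalerDr.
- by move=> x a c; rewrite scalerDl.
- by move=> v v' w; apply: (lin_D (bl w)).
- by move=> v w w'; apply: (lin_D (br v)).
- by move=> c v w; apply: (lin_Z (bl w)).
- by move=> c v w; apply: (lin_Z (br v)).
Qed.

Lemma tens_lift_class b x : bilin b ->
  tens_lift b (@ms_class k tens_setoid x) = tens_eval b x.
Proof.
move=> bb; rewrite /tens_lift asboolT //.
exact: (tens_eval_eq bb (@ms_repr_class k tens_setoid x)).
Qed.

Lemma tens_liftE b v w : bilin b -> tens_lift b (pure v w) = b v w.
Proof. exact: tens_lift_class. Qed.

Lemma tens_lift_linear b : linear (tens_lift b).
Proof.
have [bb|nb] := pselect (bilin b); last first.
  move=> c x y; rewrite /tens_lift asboolF //.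
  by rewrite scaler0 addr0.
move=> c; elim/ms_quotP=> x; elim/ms_quotP=> y.
by rewrite -ms_classZ -ms_classD !tens_lift_class.
Qed.

HB.instance Definition _ b :=
  GRing.isLinear.Build k tens U *:%R (tens_lift b) (tens_lift_linear b).

End TensorProduct.

Reserved Notation "v \ox w" (at level 40, left associativity).
Notation "v \ox w" := (pure v w).

Section TensorFacts.
Variables (k : comPzRingType) (V W : lmodType k).

Lemma tens_lift_param (P U : lmodType k) (b : P -> V -> W -> U) :
  (forall p, bilin (b p)) -> (forall v w, linear (fun p => b p v w)) ->
  forall t : tens V W, linear (fun p => tens_lift (b p) t).
Proof.
move=> bb bp; elim/tens_ind=> [|x y IHx IHy|c x IHx|v w] a p q /=.
- by rewrite !(lin_0 (tens_lift_linear _)) scaler0 addr0.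
- by rewrite !(lin_D (tens_lift_linear _)) IHx IHy scalerDr addrACA.
- by rewrite !(lin_Z (tens_lift_linear _)) IHx scalerDr !scalerA mulrC.
- rewrite !(tens_liftE _ _ (bb _)); exact: (bp v w).
Qed.

End TensorFacts.

Section Homology.
Variables (k : comPzRingType) (U V W : lmodType k).
Variables (d2 : {linear U -> V}) (d1 : {linear V -> W}).

Record cycle := Cycle { cycle_val : V; cycleP : d1 cycle_val = 0 }.

Definition cycle_zero : cycle := Cycle (linear0 d1).

Fact cycle_add_subproof (x y : cycle) : d1 (cycle_val x + cycle_val y) = 0.
Proof. by rewrite linearD !cycleP addr0. Qed.
Definition cycle_add x y : cycle := Cycle (cycle_add_subproof x y).

Fact cycle_scale_subproof c (x : cycle) : d1 (c *: cycle_val x) = 0.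
Proof. by rewrite linearZ /= cycleP scaler0. Qed.
Definition cycle_scale c x : cycle := Cycle (cycle_scale_subproof c x).

Definition homologous (x y : cycle) : Prop :=
  exists u, cycle_val x - cycle_val y = d2 u.

Lemma homologous_eq x y : cycle_val x = cycle_val y -> homologous x y.
Proof. by exists 0; rewrite linear0 H subrr. Qed.

Program Definition homology_setoid : mod_setoid k :=
  @ModSetoid k cycle homologous cycle_zero cycle_add cycle_scale
    _ _ _ _ _ _ _ _ _ _ _ _ _.
Next Obligation. exact: homologous_eq. Qed.
Next Obligation.
by case: H => u hu; exists (- u); rewrite linearN -hu opprB.
Qed.
Next Obligation.
case: H H0 => u hu [v hv]; exists (u + v).
by rewrite linearD -hu -hv addrA subrK.
Qed.
Next Obligation.
case: H H0 => u hu [v hv]; exists (u + v).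
by rewrite linearD /= -hu -hv addrACA opprD.
Qed.
Next Obligation.
by case: H => u hu; exists (c *: u); rewrite (lin_Z (linearP d2)) -hu /= scalerBr.
Qed.
Next Obligation. by apply: homologous_eq; rewrite /= addrA. Qed.
Next Obligation. by apply: homologous_eq; rewrite /= addrC. Qed.
Next Obligation. by apply: homologous_eq; rewrite /= add0r. Qed.
Next Obligation. by apply: homologous_eq; rewrite /= scaleN1r addNr. Qed.
Next Obligation. by apply: homologous_eq; rewrite /= scalerA. Qed.
Next Obligation. by apply: homologous_eq; rewrite /= scale1r. Qed.
Next Obligation. by apply: homologous_eq; rewrite /= scalerDr. Qed.
Next Obligation. by apply: homologous_eq; rewrite /= scalerDl. Qed.

Definition homology : lmodType k := ms_quot homology_setoid.

Definition homology_class (x : cycle) : homology :=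
  @ms_class k homology_setoid x.

End Homology.

Section GradedStructures.
Context {k : comPzRingType} {C : grading_category k} (e : looper C).
Context {X : obj C} (M : comm_submonoid X).

Record comm_graded_algebra := CommGradedAlgebra {
  ga_sort :> graded_module k (deg M);
  gmu : ga_sort -> ga_sort -> ga_sort;
  gone : ga_sort;
  gmu_linear_l : forall y, linear (gmu^~ y);
  gmu_linear_r : forall x, linear (gmu x);
  gone_homog : homog did gone;
  gmu_homog : forall f g (x y : ga_sort), homog f x -> homog g y ->
    homog (dcomp g f) (gmu x y);
  gmu_assoc : forall f g h (x y z : ga_sort),
    homog f x -> homog g y -> homog h z ->
    gmu (gmu x y) z = dalpha f g h *: gmu x (gmu y z);
  gmu_1l : forall f (x : ga_sort), homog f x -> gmu gone x = lunit f *: x;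
  gmu_1r : forall f (x : ga_sort), homog f x -> gmu x gone = runit f *: x;
  gmu_comm : forall f g (x y : ga_sort), homog f x -> homog g y ->
    gmu x y = deps e f g *: gmu y x
}.

Variable A : comm_graded_algebra.

Record graded_left_module := GradedLeftModule {
  lm_sort :> graded_module k (deg M);
  lact : A -> lm_sort -> lm_sort;
  lact_linear_l : forall n, linear (lact^~ n);
  lact_linear_r : forall a, linear (lact a);
  lact_homog : forall f g (a : A) (n : lm_sort), homog f a -> homog g n ->
    homog (dcomp g f) (lact a n);
  lact_assoc : forall f g h (a a' : A) (n : lm_sort),
    homog f a -> homog g a' -> homog h n ->
    lact (gmu a a') n = dalpha f g h *: lact a (lact a' n);
  lact_1 : forall g (n : lm_sort), homog g n -> lact (gone A) n = lunit g *: n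
}.

Record graded_bimodule := GradedBimodule {
  bm_sort :> graded_left_module;
  ract : bm_sort -> A -> bm_sort;
  ract_linear_l : forall b, linear (ract^~ b);
  ract_linear_r : forall n, linear (ract n);
  ract_homog : forall f g (n : bm_sort) (b : A), homog f n -> homog g b ->
    homog (dcomp g f) (ract n b);
  ract_assoc : forall f g h (n : bm_sort) (b b' : A),
    homog f n -> homog g b -> homog h b' ->
    ract (ract n b) b' = dalpha f g h *: ract n (gmu b b');
  lract_assoc : forall f g h (a : A) (n : bm_sort) (b : A),
    homog f a -> homog g n -> homog h b ->
    ract (lact a n) b = dalpha f g h *: lact a (ract n b);
  ract_1 : forall g (n : bm_sort), homog g n -> ract n (gone A) = runit g *: n
}.

Definition graded_module_iso (N N' : graded_left_module) : Prop :=
  exists phi : {linear N -> N'},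
    [/\ bijective phi,
        forall g (n : N), homog g n -> homog g (phi n)
      & forall (a : A) (n : N), phi (lact a n) = lact a (phi n)].

End GradedStructures.

Section HextManyTheory.
Variables (k : comPzRingType) (D : choiceType) (U V W : graded_module k D).
Variable T : lmodType k.

Lemma linear_bigsum (P : lmodType k) (I : Type) (s : seq I) (F : I -> P -> T) :
  (forall i, linear (F i)) -> linear (fun x => \sum_(i <- s) F i x).
Proof.
move=> Fl c x y; rewrite scaler_sumr -big_split; apply: eq_bigr => i _.
exact: Fl.
Qed.

Section Two.
Variable F : D -> D -> U -> V -> T.
Hypothesis Fl : forall f g y, linear (F f g ^~ y).
Hypothesis Fr : forall f g x, linear (F f g x).

Lemma hext2_linear_l y : linear (hext2 F ^~ y).
Proof.
by apply: hext_linear => f; apply: linear_bigsum => g; apply: Fl.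
Qed.

Lemma hext2_linear_r x : linear (hext2 F x).
Proof. by apply: linear_bigsum => f; apply: hext_linear => g; apply: Fr. Qed.

Lemma hext2_bilin : bilin (hext2 F).
Proof. by split; [apply: hext2_linear_l | apply: hext2_linear_r]. Qed.

Lemma hext2_homog f g x y : homog f x -> homog g y -> hext2 F x y = F f g x y.
Proof.
move=> hx hy; rewrite /hext2 (hext_homog _ hx).
  by rewrite (hext_homog _ hy) // => g'; apply: Fr.
by move=> f'; apply: linear_bigsum => g'; apply: Fl.
Qed.

End Two.

Section Three.
Variable F : D -> D -> D -> U -> V -> W -> T.
Hypothesis F1 : forall f g h y z, linear (fun x => F f g h x y z).
Hypothesis F2 : forall f g h x z, linear (fun y => F f g h x y z).
Hypothesis F3 : forall f g h x y, linear (F f g h x y).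

Lemma hext3_linear1 y z : linear (fun x => hext3 F x y z).
Proof.
apply: hext_linear => f; apply: linear_bigsum => g; apply: linear_bigsum => h.
exact: F1.
Qed.

Lemma hext3_linear2 x z : linear (fun y => hext3 F x y z).
Proof.
apply: linear_bigsum => f; apply: hext_linear => g; apply: linear_bigsum => h.
exact: F2.
Qed.

Lemma hext3_linear3 x y : linear (fun z => hext3 F x y z).
Proof.
apply: linear_bigsum => f; apply: linear_bigsum => g; apply: hext_linear => h.
exact: F3.
Qed.

Lemma hext3_homog f g h x y z : homog f x -> homog g y -> homog h z ->
  hext3 F x y z = F f g h x y z.
Proof.
move=> hx hy hz; rewrite /hext3 (hext_homog _ hx).
  rewrite (hext_homog _ hy); first by rewrite (hext_homog _ hz).
  by move=> g'; apply: linear_bigsum => h'; apply: F2.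
move=> f'; apply: linear_bigsum => g'; apply: linear_bigsum => h'; exact: F1.
Qed.

End Three.
End HextManyTheory.

Section Hochschild.
Context {k : comPzRingType} {C : grading_category k} {e : looper C}.
Context {X : obj C} {M : comm_submonoid X}.
Variable A : comm_graded_algebra e M.

(* The values on pure tensors of homogeneous elements are recorded in
   hoch_b1E, hoch_b2E and rhoLE below. *)
Definition hoch_b1 : {linear tens A A -> A} :=
  tens_lift (hext2 (fun (f g : deg M) (a b : A) => gmu a b - deps e f g *: gmu b a)).

Definition hoch_b2_homog (f g h : deg M) (a b c : A) : tens A A :=
  gmu a b \ox c - dalpha f g h *: (a \ox gmu b c)
  + (deps e (dcomp g f) h * uinv (dalpha h f g)) *: (gmu c a \ox b).

Definition hoch_b2 : {linear tens (tens A A) A -> tens A A} :=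
  tens_lift (fun t c => tens_lift (fun a b => hext3 hoch_b2_homog a b c) t).

Definition rhoL_homog (f g h : deg M) (x a b : A) : tens A A :=
  uinv (dalpha f g h) *: (gmu x a \ox b).

Definition rhoL (x : A) : {linear tens A A -> tens A A} :=
  tens_lift (fun a b => hext3 rhoL_homog x a b).

(* The formula for rhoL descends to HH1. This does not follow from the axioms:
   it holds if and only if, on the classes of HH1, the two ways of exchanging
   the actions of homogeneous x and c on n = a \ox b agree, that is
   eps (|n|, |c|) x (c n) = alpha (|x|, |n|, |c|)^-1 eps (|n| |x|, |c|) c (x n),
   which the looper identity alone does not force. *)
Definition rhoL_descends : Prop :=
  forall (x : A) t, (exists u, t = hoch_b2 u) -> exists u, rhoL x t = hoch_b2 u.

Definition HH1 : lmodType k := homology hoch_b2 hoch_b1.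

Lemma tens_hind (P : tens A A -> Prop) :
  P 0 -> (forall x y, P x -> P y -> P (x + y)) ->
  (forall f g (a b : A), homog f a -> homog g b -> P (a \ox b)) ->
  forall t, P t.
Proof.
move=> P0 PD Ph; have Pp a b : P (a \ox b).
  elim/homog_ind: a => [|a a' IH IH'|f a ha].
  - by rewrite (lin_0 (pure_linear_l b)).
  - by rewrite (lin_D (pure_linear_l b)); apply: PD.
  elim/homog_ind: b => [|b b' IH IH'|g b hb].
  - by rewrite (lin_0 (pure_linear_r a)).
  - by rewrite (lin_D (pure_linear_r a)); apply: PD.
  exact: Ph ha hb.
move=> t; suff: forall c, P (c *: t) by move=> /(_ 1); rewrite scale1r.
elim/tens_ind: t => [|x y IHx IHy|c' x IHx|a b] c.
- by rewrite scaler0.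
- by rewrite scalerDr; apply: PD.
- by rewrite scalerA.
by rewrite -(lin_Z (pure_linear_l b)).
Qed.

Lemma tens3_hind (P : tens (tens A A) A -> Prop) :
  P 0 -> (forall x y, P x -> P y -> P (x + y)) ->
  (forall f g h (a b c : A), homog f a -> homog g b -> homog h c ->
     P ((a \ox b) \ox c)) ->
  forall t, P t.
Proof.
move=> P0 PD Ph; have Pp t c : P (t \ox c).
  elim/tens_hind: t => [|x y IH IH'|f g a b ha hb].
  - by rewrite (lin_0 (pure_linear_l c)).
  - by rewrite (lin_D (pure_linear_l c)); apply: PD.
  elim/homog_ind: c => [|c c' IH IH'|h c hc].
  - by rewrite (lin_0 (pure_linear_r _)).
  - by rewrite (lin_D (pure_linear_r _)); apply: PD.
  exact: Ph ha hb hc.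
move=> t; suff: forall c, P (c *: t) by move=> /(_ 1); rewrite scale1r.
elim/tens_ind: t => [|x y IHx IHy|c' x IHx|a b] c.
- by rewrite scaler0.
- by rewrite scalerDr; apply: PD.
- by rewrite scalerA.
by rewrite -(lin_Z (pure_linear_l b)).
Qed.

Lemma gmul_lin y : linear (gmu (c := A) ^~ y).
Proof. exact: gmu_linear_l. Qed.

Lemma gmur_lin x : linear (gmu (c := A) x).
Proof. exact: gmu_linear_r. Qed.

Lemma purel_lin b : linear (fun a : A => a \ox b : tens A A).
Proof. exact: pure_linear_l. Qed.

Lemma purer_lin a : linear (fun b : A => a \ox b : tens A A).
Proof. exact: pure_linear_r. Qed.

Lemma linear_scale (P T : lmodType k) (s : k) (F : P -> T) :
  linear F -> linear (fun x => s *: F x).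
Proof. by move=> Fl c x y; rewrite Fl scalerDr !scalerA mulrC. Qed.

Lemma linear_add (P T : lmodType k) (F G : P -> T) :
  linear F -> linear G -> linear (fun x => F x + G x).
Proof. by move=> Fl Gl c x y; rewrite Fl Gl scalerDr addrACA. Qed.

Lemma linear_opp (P T : lmodType k) (F : P -> T) :
  linear F -> linear (fun x => - F x).
Proof. by move=> Fl c x y; rewrite Fl opprD scalerN. Qed.

Lemma linear_comp (P Q T : lmodType k) (F : P -> Q) (G : Q -> T) :
  linear F -> linear G -> linear (fun x => G (F x)).
Proof. by move=> Fl Gl c x y; rewrite Fl Gl. Qed.

Lemma b1_homog_l (f g : deg M) (b : A) :
  linear (fun a : A => gmu a b - deps e f g *: gmu b a).
Proof.
apply: linear_add; first exact: gmul_lin.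
by apply: linear_opp; apply: linear_scale; apply: gmur_lin.
Qed.

Lemma b1_homog_r (f g : deg M) (a : A) :
  linear (fun b : A => gmu a b - deps e f g *: gmu b a).
Proof.
apply: linear_add; first exact: gmur_lin.
by apply: linear_opp; apply: linear_scale; apply: gmul_lin.
Qed.

Lemma hoch_b1E f g (a b : A) : homog f a -> homog g b ->
  hoch_b1 (a \ox b) = gmu a b - deps e f g *: gmu b a.
Proof.
move=> ha hb; rewrite [LHS]tens_liftE.
  rewrite (hext2_homog _ _ ha hb) // => *; first exact: b1_homog_l.
  exact: b1_homog_r.
by apply: hext2_bilin => *; [apply: b1_homog_l|apply: b1_homog_r].
Qed.

Lemma hoch_b1_0 t : hoch_b1 t = 0.
Proof.
elim/tens_hind: t => [|x y IHx IHy|f g a b ha hb].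
- exact: linear0.
- by rewrite linearD IHx IHy addr0.
by rewrite (hoch_b1E ha hb) (gmu_comm ha hb) subrr.
Qed.

Lemma b2_homog_1 f g h b c : linear (fun a => hoch_b2_homog f g h a b c).
Proof.
apply: linear_add; first apply: linear_add.
- exact: linear_comp (gmul_lin b) (purel_lin c).
- by apply: linear_opp; apply: linear_scale; apply: purel_lin.
by apply: linear_scale; apply: linear_comp (gmur_lin c) (purel_lin b).
Qed.

Lemma b2_homog_2 f g h a c : linear (fun b => hoch_b2_homog f g h a b c).
Proof.
apply: linear_add; first apply: linear_add.
- exact: linear_comp (gmur_lin a) (purel_lin c).
- apply: linear_opp; apply: linear_scale.
  exact: linear_comp (gmul_lin c) (purer_lin a).
by apply: linear_scale; apply: purer_lin.
Qed.

Lemma b2_homog_3 f g h a b : linear (fun c => hoch_b2_homog f g h a b c).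
Proof.
apply: linear_add; first apply: linear_add.
- exact: purer_lin.
- apply: linear_opp; apply: linear_scale.
  exact: linear_comp (gmur_lin b) (purer_lin a).
by apply: linear_scale; apply: linear_comp (gmul_lin a) (purel_lin b).
Qed.

Lemma hoch_b2E f g h (a b c : A) : homog f a -> homog g b -> homog h c ->
  hoch_b2 ((a \ox b) \ox c) =
  gmu a b \ox c - dalpha f g h *: (a \ox gmu b c)
  + (deps e (dcomp g f) h * uinv (dalpha h f g)) *: (gmu c a \ox b).
Proof.
move=> ha hb hc.
have bb c' : bilin (fun a b => hext3 hoch_b2_homog a b c').
  split=> ?; [apply: hext3_linear1|apply: hext3_linear2] => *.
    exact: b2_homog_1.
  exact: b2_homog_2.
rewrite [LHS]tens_liftE.
  rewrite tens_liftE // (hext3_homog _ _ _ ha hb hc) // => *.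
  - exact: b2_homog_1.
  - exact: b2_homog_2.
  - exact: b2_homog_3.
split=> [c'|t]; first exact: tens_lift_linear.
apply: (@tens_lift_param k A A A _ (fun c a b => hext3 hoch_b2_homog a b c)) => //.
by move=> a' b'; apply: hext3_linear3 => *; apply: b2_homog_3.
Qed.

Lemma rhoL_homog_1 f g h a b : linear (fun x => rhoL_homog f g h x a b).
Proof. by apply: linear_scale; apply: linear_comp (gmul_lin a) (purel_lin b). Qed.

Lemma rhoL_homog_2 f g h x b : linear (fun a => rhoL_homog f g h x a b).
Proof. by apply: linear_scale; apply: linear_comp (gmur_lin x) (purel_lin b). Qed.

Lemma rhoL_homog_3 f g h x a : linear (rhoL_homog f g h x a).
Proof. by apply: linear_scale; apply: purer_lin. Qed.

Lemma rhoL_bilin x : bilin (hext3 rhoL_homog x).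
Proof.
split=> ?; [apply: hext3_linear2|apply: hext3_linear3] => *.
  exact: rhoL_homog_2.
exact: rhoL_homog_3.
Qed.

Lemma rhoLE f g h (x a b : A) : homog f x -> homog g a -> homog h b ->
  rhoL x (a \ox b) = uinv (dalpha f g h) *: (gmu x a \ox b).
Proof.
move=> hx ha hb; rewrite [LHS]tens_liftE; last exact: rhoL_bilin.
rewrite (hext3_homog _ _ _ hx ha hb) // => *.
- exact: rhoL_homog_1.
- exact: rhoL_homog_2.
- exact: rhoL_homog_3.
Qed.

Lemma rhoL_linear_l t : linear (rhoL^~ t).
Proof.
apply: (@tens_lift_param k A A A _ (hext3 rhoL_homog)).
  by move=> x; apply: rhoL_bilin.
by move=> a b; apply: hext3_linear1 => *; apply: rhoL_homog_1.
Qed.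

Inductive tens_homog (h : deg M) : tens A A -> Prop :=
| tens_homog0 : tens_homog h 0
| tens_homogS f g (a b : A) t :
    homog f a -> homog g b -> dcomp g f = h ->
    tens_homog h t -> tens_homog h (a \ox b + t).

Lemma tens_homogP h c x y :
  tens_homog h x -> tens_homog h y -> tens_homog h (c *: x + y).
Proof.
move=> hx hy; elim: hx => [|f g a b t ha hb hh _ IH].
  by rewrite scaler0 add0r.
rewrite scalerDr -addrA -(lin_Z (purel_lin b)).
by apply: (tens_homogS (f := f) (g := g)) => //; apply: homogZ.
Qed.

Lemma tens_homog_pure f g h (a b : A) :
  homog f a -> homog g b -> dcomp g f = h -> tens_homog h (a \ox b).
Proof.
move=> ha hb hh; rewrite -[_ \ox _]addr0.
exact: tens_homogS ha hb hh (tens_homog0 h).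
Qed.

Definition tens_proj (h : deg M) : {linear tens A A -> tens A A} :=
  tens_lift (hext2 (fun (f g : deg M) (a b : A) =>
    ((if dcomp g f == h then 1 else 0) : k) *: (a \ox b))).

Lemma tens_projE h f g (a b : A) : homog f a -> homog g b ->
  tens_proj h (a \ox b) = if dcomp g f == h then a \ox b else 0.
Proof.
have l1 f' g' (b' : A) : linear (fun a : A =>
   ((if dcomp g' f' == h then 1 else 0) : k) *: (a \ox b')).
  by apply: linear_scale; apply: purel_lin.
have l2 f' g' (a' : A) : linear (fun b : A =>
   ((if dcomp g' f' == h then 1 else 0) : k) *: (a' \ox b)).
  by apply: linear_scale; apply: purer_lin.
move=> ha hb; rewrite [LHS]tens_liftE; last by apply: hext2_bilin.
rewrite (hext2_homog _ _ ha hb) //.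
by case: ifP => _; rewrite ?scale1r ?scale0r.
Qed.

Lemma tens_proj_homog h h' t : tens_homog h' t ->
  tens_proj h t = if h' == h then t else 0.
Proof.
elim=> [|f g a b t' ha hb hh _ IH]; first by rewrite linear0 if_same.
rewrite linearD /= IH (tens_projE h ha hb) hh.
by case: ifP => _; rewrite ?addr0.
Qed.

Lemma tens_homog_b2 f g h (a b c : A) :
  homog f a -> homog g b -> homog h c ->
  tens_homog (dcomp h (dcomp g f)) (hoch_b2 ((a \ox b) \ox c)).
Proof.
move=> ha hb hc; rewrite (hoch_b2E ha hb hc).
have h1 : tens_homog (dcomp h (dcomp g f)) (gmu a b \ox c).
  exact: tens_homog_pure (gmu_homog ha hb) hc erefl.
have h2 : tens_homog (dcomp h (dcomp g f)) (a \ox gmu b c).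
  by apply: tens_homog_pure ha (gmu_homog hb hc) _; rewrite dcompA.
have h3 : tens_homog (dcomp h (dcomp g f)) (gmu c a \ox b).
  apply: tens_homog_pure (gmu_homog hc ha) hb _.
  by rewrite dcompA [RHS]dcompC.
rewrite addrC; apply: tens_homogP => //.
by rewrite addrC -scaleNr; apply: tens_homogP.
Qed.

Lemma tens_proj_b2 h u : exists v, tens_proj h (hoch_b2 u) = hoch_b2 v.
Proof.
elim/tens3_hind: u => [|x y [v hv] [w hw]|f g h' a b c ha hb hc].
- by exists 0; rewrite !linear0.
- by exists (v + w); rewrite !linearD /= hv hw.
rewrite (tens_proj_homog h (tens_homog_b2 ha hb hc)).
by case: ifP => _; [exists ((a \ox b) \ox c)|exists 0; rewrite linear0].
Qed.

Definition HH1_class (t : tens A A) : HH1 :=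
  homology_class hoch_b2 (Cycle (hoch_b1_0 t)).

Lemma HH1_class_eq t t' :
  HH1_class t = HH1_class t' <-> exists u, t - t' = hoch_b2 u.
Proof. exact: (ms_classP (S := homology_setoid hoch_b2 hoch_b1)). Qed.

Lemma HH1_ind (P : HH1 -> Prop) : (forall t, P (HH1_class t)) -> forall z, P z.
Proof.
move=> h; apply: ms_quotP => -[t ht].
by rewrite (Prop_irrelevance ht (hoch_b1_0 t)); apply: h.
Qed.

Lemma HH1_class_linear : linear HH1_class.
Proof.
move=> c x y; rewrite /HH1_class /homology_class -ms_classZ -ms_classD.
by apply/ms_classP/homologous_eq.
Qed.

Definition HH1_homog (g : deg M) : set HH1 :=
  [set z | exists2 t, tens_homog g t & z = HH1_class t].

Lemma HH1_homog0 g : HH1_homog g 0.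
Proof.
exists 0; first exact: tens_homog0.
by rewrite (lin_0 HH1_class_linear).
Qed.

Lemma HH1_homogP g c x y :
  HH1_homog g x -> HH1_homog g y -> HH1_homog g (c *: x + y).
Proof.
move=> [t ht ->] [u hu ->]; exists (c *: t + u); first exact: tens_homogP.
by rewrite HH1_class_linear.
Qed.

Lemma HH1_span z : exists (s : seq (deg M)) (y : deg M -> HH1),
  [/\ uniq s, forall g, HH1_homog g (y g) & z = \sum_(g <- s) y g].
Proof.
elim/HH1_ind: z; elim/tens_hind=> [|x y hx hy|f g a b ha hb].
- by rewrite (lin_0 HH1_class_linear); apply: (spanned0 HH1_homog0).
- rewrite (lin_D HH1_class_linear).
  exact: (spannedD HH1_homog0 HH1_homogP hx hy).
apply: (spanned_homog HH1_homog0 (g := dcomp g f)); exists (a \ox b) => //.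
exact: tens_homog_pure ha hb erefl.
Qed.

Lemma HH1_indep (s : seq (deg M)) (y : deg M -> HH1) :
  uniq s -> (forall g, HH1_homog g (y g)) -> \sum_(g <- s) y g = 0 ->
  forall g, g \in s -> y g = 0.
Proof.
move=> us hy sy g gs.
have /choice [t ht] : forall h, exists t, tens_homog h t /\ y h = HH1_class t.
  by move=> h; have [t ? ?] := hy h; exists t.
have yE h : y h = HH1_class (t h) by have [] := ht h.
move: sy; rewrite (eq_bigr _ (fun h _ => yE h)) -(lin_sum HH1_class_linear).
rewrite -(lin_0 HH1_class_linear) => /HH1_class_eq [u]; rewrite subr0 => hu.
rewrite yE; apply/HH1_class_eq.
have [v hv] := tens_proj_b2 g u; exists v; rewrite subr0 -hv -hu.
rewrite linear_sum -[LHS](big_seq1 +%R g) -(sum_uniq_sub (s' := s)) //.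
  apply: eq_bigr => h _; have [hh _] := ht h.
  by rewrite (tens_proj_homog g hh) mem_seq1.
by move=> h; rewrite mem_seq1 => /eqP ->.
Qed.

Definition HH1_graded : graded_module k (deg M) :=
  GradedModule HH1_homog0 HH1_homogP HH1_span HH1_indep.

End Hochschild.

Section HH1Module.
Context {k : comPzRingType} {C : grading_category k} {e : looper C}.
Context {X : obj C} {M : comm_submonoid X}.
Variable A : comm_graded_algebra e M.
Hypothesis hL : rhoL_descends A.

Definition HH1_act (x : A) (z : HH1 A) : HH1 A :=
  HH1_class (rhoL x (cycle_val (ms_repr z))).

Lemma HH1_actE x t : HH1_act x (HH1_class t) = HH1_class (rhoL x t).
Proof.
have := @ms_repr_class _ (homology_setoid (hoch_b2 A) (hoch_b1 A))
  (Cycle (hoch_b1_0 t)); rewrite -[ms_class _]/(HH1_class t) => ht.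
apply/HH1_class_eq; rewrite -linearB; apply: hL; exact: ht.
Qed.

Lemma HH1_act_linear_l z : linear (HH1_act^~ z).
Proof.
move: z; apply: HH1_ind => t c x y.
by rewrite !HH1_actE rhoL_linear_l HH1_class_linear.
Qed.

Lemma HH1_act_linear_r x : linear (HH1_act x).
Proof.
move=> c; apply: HH1_ind => t; apply: HH1_ind => u.
by rewrite -HH1_class_linear !HH1_actE linearP HH1_class_linear.
Qed.

Lemma rhoL_tens_homog f g (x : A) t :
  homog f x -> tens_homog g t -> tens_homog (dcomp g f) (rhoL x t).
Proof.
move=> hx; elim=> [|p q a b t' ha hb <- _ IH].
  by rewrite linear0; apply: tens_homog0.
rewrite linearD /= (rhoLE hx ha hb); apply: tens_homogP => //.
apply: tens_homog_pure (gmu_homog hx ha) hb _; exact: dcompA.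
Qed.

Lemma rhoL_assoc f g h (a a' : A) t :
  homog f a -> homog g a' -> tens_homog h t ->
  rhoL (gmu a a') t = dalpha f g h *: rhoL a (rhoL a' t).
Proof.
move=> ha ha'; elim=> [|p q b c t' hb hc <- _ IH].
  by rewrite !linear0 ?scaler0.
rewrite !(lin_D (linearP (rhoL _))) scalerDr -IH; congr (_ + _).
rewrite (rhoLE (gmu_homog ha ha') hb hc) (rhoLE ha' hb hc).
rewrite linearZ /= (rhoLE ha (gmu_homog ha' hb) hc) (gmu_assoc ha ha' hb).
rewrite (lin_Z (purel_lin c)) !scalerA; congr (_ *: _).
have := dalpha_cocycle f g p q.
case: (dalpha f g p) (dalpha f g (dcomp q p)) (dalpha f (dcomp p g) q)
  (dalpha (dcomp g f) p q) (dalpha g p q)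
  => [u1 v1 e1] [u2 v2 e2] [u3 v3 e3] [u4 v4 e4] [u5 v5 e5] /= E.
rewrite -[RHS]mulr1 -E.
transitivity (v4 * u1 * ((u2 * v2) * (u3 * v3) * (u5 * v5))); last by ring.
by rewrite e2 e3 e5 !mulr1.
Qed.

Lemma rhoL_1 g t : tens_homog g t -> rhoL (gone A) t = lunit g *: t.
Proof.
elim=> [|p q b c t' hb hc <- _ IH]; first by rewrite linear0 scaler0.
rewrite linearD /= IH scalerDr; congr (_ + _).
rewrite (rhoLE (gone_homog A) hb hc) (gmu_1l hb).
rewrite (lin_Z (purel_lin c)) !scalerA; congr (_ *: _); rewrite /lunit.
have := dalpha_cocycle (M := M) did did p q; rewrite dcompidr dcompidl.
case: (dalpha did did p) (dalpha did did (dcomp q p)) (dalpha did p q)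
  => [u1 v1 e1] [u2 v2 e2] [u3 v3 e3] /= E.
rewrite -[LHS]mulr1 -E.
transitivity (v2 * ((u1 * v1) * (u3 * v3) * (u3 * v3))); first by ring.
by rewrite e1 e3 !mulr1.
Qed.

Lemma HH1_act_homog f g (a : A) (n : HH1_graded A) :
  homog f a -> homog g n -> HH1_homog (dcomp g f) (HH1_act a n).
Proof.
move=> ha [t ht ->]; rewrite HH1_actE; exists (rhoL a t) => //.
exact: rhoL_tens_homog.
Qed.

Lemma HH1_act_assoc f g h (a a' : A) (n : HH1_graded A) :
  homog f a -> homog g a' -> homog h n ->
  HH1_act (gmu a a') n = dalpha f g h *: HH1_act a (HH1_act a' n).
Proof.
move=> ha ha' [t ht ->]; rewrite !HH1_actE -(lin_Z (@HH1_class_linear _ _ _ _ _ A)).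
by rewrite (rhoL_assoc ha ha' ht).
Qed.

Lemma HH1_act_1 g (n : HH1_graded A) :
  homog g n -> HH1_act (gone A) n = lunit g *: n.
Proof.
move=> [t ht ->]; rewrite HH1_actE (rhoL_1 ht).
by rewrite (lin_Z (@HH1_class_linear _ _ _ _ _ A)).
Qed.

Definition HH1_module : graded_left_module A :=
  @GradedLeftModule _ _ _ _ _ A (HH1_graded A) HH1_act HH1_act_linear_l
    HH1_act_linear_r HH1_act_homog HH1_act_assoc HH1_act_1.

End HH1Module.

Section Kaehler.
Context {k : comPzRingType} {C : grading_category k} {e : looper C}.
Context {X : obj C} {M : comm_submonoid X}.
Variable A : comm_graded_algebra e M.

(* Omega is the quotient of the formal bimodule expressions in the symbols
   d a by the smallest congruence containing the axioms of graded bimodules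
   and the relations of the presentation. *)
Inductive kd_expr :=
| kd_zero
| kd_add of kd_expr & kd_expr
| kd_scale of k & kd_expr
| kd_d of A
| kd_l of A & kd_expr
| kd_r of kd_expr & A.

Inductive kd_homog : deg M -> kd_expr -> Prop :=
| kdh_zero g : kd_homog g kd_zero
| kdh_add g x y : kd_homog g x -> kd_homog g y -> kd_homog g (kd_add x y)
| kdh_scale g c x : kd_homog g x -> kd_homog g (kd_scale c x)
| kdh_d g a : homog g a -> kd_homog g (kd_d a)
| kdh_l f g a x : homog f a -> kd_homog g x -> kd_homog (dcomp g f) (kd_l a x)
| kdh_r f g x b : kd_homog f x -> homog g b -> kd_homog (dcomp g f) (kd_r x b).

Inductive kd_eq : kd_expr -> kd_expr -> Prop :=
| kd_refl x : kd_eq x x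
| kd_sym x y : kd_eq x y -> kd_eq y x
| kd_trans x y z : kd_eq x y -> kd_eq y z -> kd_eq x z
| kd_addP x x' y y' :
    kd_eq x x' -> kd_eq y y' -> kd_eq (kd_add x y) (kd_add x' y')
| kd_scaleP c x x' : kd_eq x x' -> kd_eq (kd_scale c x) (kd_scale c x')
| kd_lP a x x' : kd_eq x x' -> kd_eq (kd_l a x) (kd_l a x')
| kd_rP b x x' : kd_eq x x' -> kd_eq (kd_r x b) (kd_r x' b)
| kd_addA x y z : kd_eq (kd_add x (kd_add y z)) (kd_add (kd_add x y) z)
| kd_addC x y : kd_eq (kd_add x y) (kd_add y x)
| kd_add0 x : kd_eq (kd_add kd_zero x) x
| kd_addN x : kd_eq (kd_add (kd_scale (-1) x) x) kd_zero
| kd_scaleA s t x : kd_eq (kd_scale s (kd_scale t x)) (kd_scale (s * t) x)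
| kd_scale1 x : kd_eq (kd_scale 1 x) x
| kd_scaleDr s x y :
    kd_eq (kd_scale s (kd_add x y)) (kd_add (kd_scale s x) (kd_scale s y))
| kd_scaleDl x s t :
    kd_eq (kd_scale (s + t) x) (kd_add (kd_scale s x) (kd_scale t x))
| kd_lDl a a' x : kd_eq (kd_l (a + a') x) (kd_add (kd_l a x) (kd_l a' x))
| kd_lZl s a x : kd_eq (kd_l (s *: a) x) (kd_scale s (kd_l a x))
| kd_lDr a x y : kd_eq (kd_l a (kd_add x y)) (kd_add (kd_l a x) (kd_l a y))
| kd_lZr s a x : kd_eq (kd_l a (kd_scale s x)) (kd_scale s (kd_l a x))
| kd_rDl x y b : kd_eq (kd_r (kd_add x y) b) (kd_add (kd_r x b) (kd_r y b))
| kd_rZl s x b : kd_eq (kd_r (kd_scale s x) b) (kd_scale s (kd_r x b))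
| kd_rDr x b b' : kd_eq (kd_r x (b + b')) (kd_add (kd_r x b) (kd_r x b'))
| kd_rZr s x b : kd_eq (kd_r x (s *: b)) (kd_scale s (kd_r x b))
| kd_lA f g h a a' x : homog f a -> homog g a' -> kd_homog h x ->
    kd_eq (kd_l (gmu a a') x) (kd_scale (uval (dalpha f g h)) (kd_l a (kd_l a' x)))
| kd_l1 g x : kd_homog g x -> kd_eq (kd_l (gone A) x) (kd_scale (lunit g) x)
| kd_rA f g h x b b' : kd_homog f x -> homog g b -> homog h b' ->
    kd_eq (kd_r (kd_r x b) b') (kd_scale (uval (dalpha f g h)) (kd_r x (gmu b b')))
| kd_lrA f g h a x b : homog f a -> kd_homog g x -> homog h b ->
    kd_eq (kd_r (kd_l a x) b) (kd_scale (uval (dalpha f g h)) (kd_l a (kd_r x b)))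
| kd_r1 g x : kd_homog g x -> kd_eq (kd_r x (gone A)) (kd_scale (runit g) x)
| kd_dD a a' : kd_eq (kd_d (a + a')) (kd_add (kd_d a) (kd_d a'))
| kd_dZ s a : kd_eq (kd_d (s *: a)) (kd_scale s (kd_d a))
| kd_leibniz a b :
    kd_eq (kd_d (gmu a b)) (kd_add (kd_l a (kd_d b)) (kd_r (kd_d a) b))
| kd_symm f g x b : kd_homog f x -> homog g b ->
    kd_eq (kd_r x b) (kd_scale (uval (deps e f g)) (kd_l b x)).

Definition kd_setoid : mod_setoid k :=
  ModSetoid kd_refl kd_sym kd_trans kd_addP kd_scaleP kd_addA kd_addC kd_add0
    kd_addN kd_scaleA kd_scale1 kd_scaleDr kd_scaleDl.

Definition kd_mod : lmodType k := ms_quot kd_setoid.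

Definition kd_class (x : kd_expr) : kd_mod := @ms_class k kd_setoid x.

Lemma kd_classP x y : kd_class x = kd_class y <-> kd_eq x y.
Proof. exact: (@ms_classP k kd_setoid). Qed.

Lemma kd_classD x y : kd_class (kd_add x y) = kd_class x + kd_class y.
Proof. exact: (@ms_classD k kd_setoid). Qed.

Lemma kd_classZ c x : kd_class (kd_scale c x) = c *: kd_class x.
Proof. exact: (@ms_classZ k kd_setoid). Qed.

Lemma kd_class0 : kd_class kd_zero = 0.
Proof. by []. Qed.

Lemma kd_mod_ind (P : kd_mod -> Prop) :
  (forall x, P (kd_class x)) -> forall z, P z.
Proof. exact: (@ms_quotP k kd_setoid). Qed.

Lemma kd_repr_class x : kd_eq (@ms_repr k kd_setoid (kd_class x)) x.
Proof. exact: (@ms_repr_class k kd_setoid). Qed.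

Definition kd_lact (a : A) (z : kd_mod) : kd_mod :=
  kd_class (kd_l a (@ms_repr k kd_setoid z)).

Definition kd_ract (z : kd_mod) (b : A) : kd_mod :=
  kd_class (kd_r (@ms_repr k kd_setoid z) b).

Definition kd_diff (a : A) : kd_mod := kd_class (kd_d a).

Definition kd_mod_homog (g : deg M) : set kd_mod :=
  [set z | exists2 x, kd_homog g x & z = kd_class x].

Lemma kd_lactE a x : kd_lact a (kd_class x) = kd_class (kd_l a x).
Proof. by apply/kd_classP/kd_lP/kd_repr_class. Qed.

Lemma kd_ractE x b : kd_ract (kd_class x) b = kd_class (kd_r x b).
Proof. by apply/kd_classP/kd_rP/kd_repr_class. Qed.

Lemma kd_lact_linear_l z : linear (kd_lact^~ z).
Proof.
move: z; apply: kd_mod_ind => x c a a'; rewrite !kd_lactE -kd_classZ -kd_classD.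
apply/kd_classP; apply: kd_trans (kd_lDl _ _ _) _.
by apply: kd_addP (kd_refl _); apply: kd_lZl.
Qed.

Lemma kd_lact_linear_r a : linear (kd_lact a).
Proof.
move=> c; apply: kd_mod_ind => x; apply: kd_mod_ind => y.
rewrite -kd_classZ -kd_classD !kd_lactE -kd_classZ -kd_classD.
apply/kd_classP; apply: kd_trans (kd_lDr _ _ _) _.
by apply: kd_addP (kd_refl _); apply: kd_lZr.
Qed.

Lemma kd_ract_linear_l b : linear (kd_ract^~ b).
Proof.
move=> c; apply: kd_mod_ind => x; apply: kd_mod_ind => y.
rewrite -kd_classZ -kd_classD !kd_ractE -kd_classZ -kd_classD.
apply/kd_classP; apply: kd_trans (kd_rDl _ _ _) _.
by apply: kd_addP (kd_refl _); apply: kd_rZl.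
Qed.

Lemma kd_ract_linear_r z : linear (kd_ract z).
Proof.
move: z; apply: kd_mod_ind => x c b b'; rewrite !kd_ractE -kd_classZ -kd_classD.
apply/kd_classP; apply: kd_trans (kd_rDr _ _ _) _.
by apply: kd_addP (kd_refl _); apply: kd_rZr.
Qed.

Lemma kd_diff_linear : linear kd_diff.
Proof.
move=> c a a'; rewrite /kd_diff -kd_classZ -kd_classD.
apply/kd_classP; apply: kd_trans (kd_dD _ _) _.
by apply: kd_addP (kd_refl _); apply: kd_dZ.
Qed.

Lemma kd_mod_homog0 g : kd_mod_homog g 0.
Proof. by exists kd_zero; first exact: kdh_zero. Qed.

Lemma kd_mod_homogP g (c : k) x y :
  kd_mod_homog g x -> kd_mod_homog g y -> kd_mod_homog g (c *: x + y).
Proof.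
move=> [t ht ->] [u hu ->]; exists (kd_add (kd_scale c t) u).
  by apply: kdh_add => //; apply: kdh_scale.
by rewrite kd_classD kd_classZ.
Qed.

Lemma kd_lact_homog f g (a : A) n :
  homog f a -> kd_mod_homog g n -> kd_mod_homog (dcomp g f) (kd_lact a n).
Proof.
move=> ha [x hx ->]; rewrite kd_lactE; exists (kd_l a x) => //.
exact: kdh_l.
Qed.

Lemma kd_ract_homog f g n (b : A) :
  kd_mod_homog f n -> homog g b -> kd_mod_homog (dcomp g f) (kd_ract n b).
Proof.
move=> [x hx ->] hb; rewrite kd_ractE; exists (kd_r x b) => //.
exact: kdh_r.
Qed.

(* The projection of the class of x to the degrees satisfying P. *)
Fixpoint kd_proj (x : kd_expr) (P : pred (deg M)) : kd_mod :=
  match x with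
  | kd_zero => 0
  | kd_add x y => kd_proj x P + kd_proj y P
  | kd_scale c x => c *: kd_proj x P
  | kd_d a => hext (fun g a' => if P g then kd_diff a' else 0) a
  | kd_l a x =>
      hext (fun f a' => kd_lact a' (kd_proj x (fun g => P (dcomp g f)))) a
  | kd_r x b =>
      hext (fun g b' => kd_ract (kd_proj x (fun f => P (dcomp g f))) b') b
  end.

Lemma linear_if (U V : lmodType k) (c : bool) (F : U -> V) :
  linear F -> linear (fun x => if c then F x else 0).
Proof. by move=> Fl s x y; case: c; [apply: Fl | rewrite scaler0 addr0]. Qed.

Lemma kd_proj_d_lin P : linear (fun a => kd_proj (kd_d a) P).
Proof. by apply: hext_linear => g; apply: linear_if; apply: kd_diff_linear. Qed.

Lemma kd_proj_l_lin x P : linear (fun a => kd_proj (kd_l a x) P).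
Proof. by apply: hext_linear => g; apply: kd_lact_linear_l. Qed.

Lemma kd_proj_r_lin x P : linear (fun b => kd_proj (kd_r x b) P).
Proof. by apply: hext_linear => g; apply: kd_ract_linear_r. Qed.

Lemma kd_proj_homog h x : kd_homog h x ->
  forall P, kd_proj x P = if P h then kd_class x else 0.
Proof.
elim=> {h x} [g|g x y _ IHx _ IHy|g c x _ IHx|g a ha|f g a x ha _ IH
             |f g x b _ IH hb] P /=.
- by rewrite kd_class0 if_same.
- by rewrite IHx IHy kd_classD; case: ifP => _; rewrite ?addr0.
- by rewrite IHx kd_classZ; case: ifP => _; rewrite ?scaler0.
- by rewrite (hext_homog _ ha) // => g'; apply: linear_if; apply: kd_diff_linear.
- rewrite (hext_homog _ ha); last by move=> f'; apply: kd_lact_linear_l.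
  rewrite IH; case: ifP => _; first by rewrite kd_lactE.
  by rewrite (lin_0 (kd_lact_linear_r a)).
rewrite (hext_homog _ hb); last by move=> f'; apply: kd_ract_linear_r.
rewrite IH; case: ifP => _; first by rewrite kd_ractE.
by rewrite (lin_0 (kd_ract_linear_l b)).
Qed.

Lemma kd_proj_eq_homog h x y : kd_homog h x -> kd_homog h y -> kd_eq x y ->
  forall P, kd_proj x P = kd_proj y P.
Proof.
move=> hx hy /kd_classP xy P.
by rewrite (kd_proj_homog hx) (kd_proj_homog hy) xy.
Qed.

Lemma kd_proj_leibniz a b P :
  kd_proj (kd_d (gmu a b)) P =
  kd_proj (kd_add (kd_l a (kd_d b)) (kd_r (kd_d a) b)) P.
Proof.
pose F a b := kd_proj (kd_d (gmu a b)) P.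
pose G a b := kd_proj (kd_l a (kd_d b)) P + kd_proj (kd_r (kd_d a) b) P.
have Fl b' : linear (F^~ b').
  exact: linear_comp (gmul_lin b') (kd_proj_d_lin P).
have Fr a' : linear (F a').
  exact: linear_comp (gmur_lin a') (kd_proj_d_lin P).
have Gl b' : linear (G^~ b').
  apply: (linear_add (kd_proj_l_lin (kd_d b') P)).
  apply: linear_bigsum => g.
  exact: linear_comp (kd_proj_d_lin _) (kd_ract_linear_l _).
have Gr a' : linear (G a').
  apply: linear_add (kd_proj_r_lin (kd_d a') P).
  apply: linear_bigsum => g.
  exact: linear_comp (kd_proj_d_lin _) (kd_lact_linear_r _).
rewrite -[LHS]/(F a b) -[RHS]/(G a b).
elim/homog_ind: a => [|a a' IH IH'|f a ha].
- by rewrite (lin_0 (Fl b)) (lin_0 (Gl b)).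
- by rewrite (lin_D (Fl b)) (lin_D (Gl b)) IH IH'.
elim/homog_ind: b => [|b b' IH IH'|g b hb].
- by rewrite (lin_0 (Fr a)) (lin_0 (Gr a)).
- by rewrite (lin_D (Fr a)) (lin_D (Gr a)) IH IH'.
rewrite /F -[G a b]/(kd_proj (kd_add (kd_l a (kd_d b)) (kd_r (kd_d a) b)) P).
apply: (@kd_proj_eq_homog (dcomp g f)); last exact: kd_leibniz.
  by apply: kdh_d; apply: gmu_homog.
by apply: kdh_add; [apply: kdh_l | apply: kdh_r] => //; apply: kdh_d.
Qed.

Lemma kd_proj_eq x y : kd_eq x y -> forall P, kd_proj x P = kd_proj y P.
Proof.
elim=> {x y} //=.
- by move=> x y z _ IH _ IH' P; rewrite IH.
- by move=> x x' y y' _ IH _ IH' P; rewrite IH IH'.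
- by move=> c x x' _ IH P; rewrite IH.
- by move=> a x x' _ IH P; apply: eq_bigr => f _; rewrite IH.
- by move=> b x x' _ IH P; apply: eq_bigr => f _; rewrite IH.
- by move=> x y z P; rewrite addrA.
- by move=> x y P; rewrite addrC.
- by move=> x P; rewrite add0r.
- by move=> x P; rewrite scaleN1r addNr.
- by move=> s t x P; rewrite scalerA.
- by move=> x P; rewrite scale1r.
- by move=> s x y P; rewrite scalerDr.
- by move=> x s t P; rewrite scalerDl.
- by move=> a a' x P; apply: (lin_D (kd_proj_l_lin x P)).
- by move=> s a x P; apply: (lin_Z (kd_proj_l_lin x P)).
- move=> a x y P; rewrite /hext -big_split; apply: eq_bigr => f _ /=.
  exact: (lin_D (kd_lact_linear_r _)).
- move=> s a x P; rewrite /hext scaler_sumr; apply: eq_bigr => f _ /=.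
  exact: (lin_Z (kd_lact_linear_r _)).
- move=> x y b P; rewrite /hext -big_split; apply: eq_bigr => f _ /=.
  exact: (lin_D (kd_ract_linear_l _)).
- move=> s x b P; rewrite /hext scaler_sumr; apply: eq_bigr => f _ /=.
  exact: (lin_Z (kd_ract_linear_l _)).
- by move=> x b b' P; apply: (lin_D (kd_proj_r_lin x P)).
- by move=> s x b P; apply: (lin_Z (kd_proj_r_lin x P)).
- move=> f g h a a' x ha ha' hx; apply: kd_proj_eq_homog (kd_lA ha ha' hx).
    exact: kdh_l (gmu_homog ha ha') hx.
  by rewrite dcompA; apply/kdh_scale/kdh_l/kdh_l.
- move=> g x hx; apply: kd_proj_eq_homog (kd_l1 hx).
    exact: kdh_l (gone_homog A) hx.
  by rewrite dcompidr; apply: kdh_scale.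
- move=> f g h x b b' hx hb hb'; apply: kd_proj_eq_homog (kd_rA hx hb hb').
    exact: kdh_r (kdh_r hx hb) hb'.
  by rewrite dcompA; apply/kdh_scale/kdh_r => //; apply: gmu_homog.
- move=> f g h a x b ha hx hb; apply: kd_proj_eq_homog (kd_lrA ha hx hb).
    exact: kdh_r (kdh_l ha hx) hb.
  by rewrite dcompA; apply/kdh_scale/kdh_l => //; apply: kdh_r.
- move=> g x hx; apply: kd_proj_eq_homog (kd_r1 hx).
    exact: kdh_r hx (gone_homog A).
  by rewrite dcompidl; apply: kdh_scale.
- by move=> a a' P; apply: (lin_D (kd_proj_d_lin P)).
- by move=> s a P; apply: (lin_Z (kd_proj_d_lin P)).
- by move=> a b P; apply: kd_proj_leibniz.
move=> f g x b hx hb; apply: kd_proj_eq_homog (kd_symm hx hb).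
  exact: kdh_r hx hb.
by rewrite dcompC; apply/kdh_scale/kdh_l.
Qed.

Lemma kd_span z : exists (s : seq (deg M)) (y : deg M -> kd_mod),
  [/\ uniq s, forall g, kd_mod_homog g (y g) & z = \sum_(g <- s) y g].
Proof.
have S0 := spanned0 kd_mod_homog0.
have SD := spannedD kd_mod_homog0 kd_mod_homogP.
have SH := spanned_homog kd_mod_homog0.
move: z; apply: kd_mod_ind; elim=> [|x IHx y IHy|c x IHx|a|a x IHx|x IHx b].
- exact: S0.
- by rewrite kd_classD; apply: SD.
- by rewrite kd_classZ; apply: (spannedZ kd_mod_homog0 kd_mod_homogP).
- rewrite -/(kd_diff a); elim/homog_ind: a => [|a a' IH IH'|g a ha].
  + by rewrite (lin_0 kd_diff_linear); apply: S0.
  + by rewrite (lin_D kd_diff_linear); apply: SD.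
  by apply: (SH g); exists (kd_d a) => //; apply: kdh_d.
- rewrite -kd_lactE; move: (kd_class x) IHx; apply: spanned_ind.
  + by rewrite (lin_0 (kd_lact_linear_r a)); apply: S0.
  + by move=> u v hu hv; rewrite (lin_D (kd_lact_linear_r a)); apply: SD.
  move=> g u hu; elim/homog_ind: a => [|a a' IH IH'|f a ha].
  + by rewrite (lin_0 (kd_lact_linear_l u)); apply: S0.
  + by rewrite (lin_D (kd_lact_linear_l u)); apply: SD.
  exact: SH _ _ (kd_lact_homog ha hu).
rewrite -kd_ractE; move: (kd_class x) IHx; apply: spanned_ind.
+ by rewrite (lin_0 (kd_ract_linear_l b)); apply: S0.
+ by move=> u v hu hv; rewrite (lin_D (kd_ract_linear_l b)); apply: SD.
move=> g u hu; elim/homog_ind: b => [|b b' IH IH'|f b hb].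
+ by rewrite (lin_0 (kd_ract_linear_r u)); apply: S0.
+ by rewrite (lin_D (kd_ract_linear_r u)); apply: SD.
exact: SH _ _ (kd_ract_homog hu hb).
Qed.

Definition kd_mod_proj (P : pred (deg M)) (z : kd_mod) : kd_mod :=
  kd_proj (@ms_repr k kd_setoid z) P.

Lemma kd_mod_projE P x : kd_mod_proj P (kd_class x) = kd_proj x P.
Proof. exact/kd_proj_eq/kd_repr_class. Qed.

Lemma kd_mod_proj_linear P : linear (kd_mod_proj P).
Proof.
move=> c; apply: kd_mod_ind => x; apply: kd_mod_ind => y.
by rewrite -kd_classZ -kd_classD !kd_mod_projE.
Qed.

Lemma kd_indep (s : seq (deg M)) (y : deg M -> kd_mod) :
  uniq s -> (forall g, kd_mod_homog g (y g)) -> \sum_(g <- s) y g = 0 ->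
  forall g, g \in s -> y g = 0.
Proof.
move=> us hy sy g gs; have := congr1 (kd_mod_proj (pred1 g)) sy.
rewrite (lin_0 (kd_mod_proj_linear _)) (lin_sum (kd_mod_proj_linear _)) => <-.
rewrite -[LHS](big_seq1 +%R g) -(sum_uniq_sub (s' := s)) //; last first.
  by move=> h; rewrite mem_seq1 => /eqP ->.
apply: eq_bigr => h _; have [x hx ->] := hy h.
by rewrite kd_mod_projE (kd_proj_homog hx) mem_seq1.
Qed.

Definition kd_graded : graded_module k (deg M) :=
  GradedModule kd_mod_homog0 kd_mod_homogP kd_span kd_indep.

Lemma kd_lact_assoc f g h (a a' : A) (n : kd_graded) :
  homog f a -> homog g a' -> homog h n ->
  kd_lact (gmu a a') n = dalpha f g h *: kd_lact a (kd_lact a' n).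
Proof.
move=> ha ha' [x hx ->]; rewrite !kd_lactE -kd_classZ.
exact/kd_classP/kd_lA.
Qed.

Lemma kd_lact_1 g (n : kd_graded) :
  homog g n -> kd_lact (gone A) n = lunit g *: n.
Proof.
move=> [x hx ->]; rewrite kd_lactE -kd_classZ; exact/kd_classP/kd_l1.
Qed.

Definition kd_left_module : graded_left_module A :=
  @GradedLeftModule _ _ _ _ _ A kd_graded kd_lact kd_lact_linear_l
    kd_lact_linear_r kd_lact_homog kd_lact_assoc kd_lact_1.

Lemma kd_ract_assoc f g h (n : kd_left_module) (b b' : A) :
  homog f n -> homog g b -> homog h b' ->
  kd_ract (kd_ract n b) b' = dalpha f g h *: kd_ract n (gmu b b').
Proof.
move=> [x hx ->] hb hb'; rewrite !kd_ractE -kd_classZ.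
exact/kd_classP/kd_rA.
Qed.

Lemma kd_lract_assoc f g h (a : A) (n : kd_left_module) (b : A) :
  homog f a -> homog g n -> homog h b ->
  kd_ract (kd_lact a n) b = dalpha f g h *: kd_lact a (kd_ract n b).
Proof.
move=> ha [x hx ->] hb; rewrite kd_lactE !kd_ractE kd_lactE -kd_classZ.
exact/kd_classP/kd_lrA.
Qed.

Lemma kd_ract_1 g (n : kd_left_module) :
  homog g n -> kd_ract n (gone A) = runit g *: n.
Proof.
move=> [x hx ->]; rewrite kd_ractE -kd_classZ; exact/kd_classP/kd_r1.
Qed.

Definition Omega1 : graded_bimodule A :=
  @GradedBimodule _ _ _ _ _ A kd_left_module kd_ract kd_ract_linear_l
    kd_ract_linear_r kd_ract_homog kd_ract_assoc kd_lract_assoc kd_ract_1.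

End Kaehler.

(* Main.v *)
(* The differential d b = alpha(Id, Id, |b|) [1 \ox b] generates HH_1, since
   [a \ox b] = a . d b.  The Hochschild relation b_2(1, a, b) is the Leibniz rule,
   and then b_2(a, b, c) becomes the exchange law
     alpha(x, n, c) eps(n, c) x (c n) = eps(n x, c) c (x n)
   for n = d b; the pentagon extends it to n = a . d b.  Hence
   n . b = eps(|n|, |b|) b . n is a right action on HH_1 commuting with the left
   one.  Its associativity, which the looper axiom does not give, follows from
   computing d ((z b) b') = alpha(z, b, b') d (z (b b')) in two ways.  So HH_1 is
   a symmetric bimodule with a derivation, which yields Omega^1 -> HH_1; its
   inverse is [a \ox b] |-> a . db. *)
From HB Require Import structures.
Require Import Defs.
From mathcomp Require Import all_boot all_algebra.
From mathcomp Require Import ring.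

Set Implicit Arguments.
Unset Strict Implicit.
Unset Printing Implicit Defensive.

Import GRing.Theory.
Local Open Scope ring_scope.

(** * Cancellation of units *)

Section Units.
Variables (k : comPzRingType) (u : unit_of k).

Lemma unit_scaleK (V : lmodType k) (x : V) : uinv u *: (u *: x : V) = x.
Proof. by rewrite scalerA mulrC uvalK scale1r. Qed.

Lemma unit_scaleI (V : lmodType k) (x y : V) : u *: x = u *: y -> x = y.
Proof. by move=> xy; rewrite -[x]unit_scaleK xy unit_scaleK. Qed.

Lemma unit_mulI (x y : k) : u * x = u * y -> x = y.
Proof. exact: (@unit_scaleI k^o). Qed.

End Units.

(** * The pentagon, and associator and looper at the identity degree *)

Section Constraints.
Context {k : comPzRingType} {C : grading_category k} {e : looper C}.
Context {X : obj C} {M : comm_submonoid X}.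
Implicit Types f g h : deg M.

Lemma dalpha_pentagon f1 f2 f3 f4 :
  dalpha f1 f2 f3 * dalpha f1 (dcomp f3 f2) f4 * dalpha f2 f3 f4
  = dalpha f1 f2 (dcomp f4 f3) * dalpha (dcomp f2 f1) f3 f4 :> k.
Proof.
have := dalpha_cocycle f1 f2 f3 f4.
have := uvalK (dalpha (dcomp f2 f1) f3 f4).
have := uvalK (dalpha f1 f2 (dcomp f4 f3)).
set a := dalpha f1 f2 _; set b := dalpha (dcomp f2 f1) _ _ => ha hb E.
rewrite -[RHS]mulr1 -E.
transitivity ((a * uinv a) * (b * uinv b) *
  (dalpha f1 f2 f3 * dalpha f1 (dcomp f3 f2) f4 * dalpha f2 f3 f4)).
  by rewrite ha hb !mul1r.
by ring.
Qed.

(** In the pentagon at (Id, g, Id, Id) this unit occurs twice on the left and once on the right, and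
    [dalpha g did did] once on each side. *)
Lemma dalpha_1g1 g : uval (dalpha did g did) = 1.
Proof.
have := dalpha_pentagon did g did did; rewrite !dcompidl dcompidr.
rewrite -mulrA => /unit_mulI; rewrite -[RHS]mul1r mulrC [RHS]mulrC.
exact: unit_mulI.
Qed.

(** The pentagon at (Id, Id, f, g), with one factor [dalpha did f g] cancelled. *)
Lemma dalpha_1fg f g :
  dalpha did did f * dalpha did f g = uval (dalpha did did (dcomp g f)).
Proof.
have := dalpha_pentagon did did f g; rewrite dcompidr dcompidl.
by rewrite mulrC [RHS]mulrC => /unit_mulI.
Qed.

(** The pentagon at (f, Id, Id, g), with one factor [dalpha f did g] cancelled. *)
Lemma dalpha_f1g f g :
  uval (dalpha f did g) = dalpha f did did * dalpha did did g.
Proof.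
have := dalpha_pentagon f did did g; rewrite !dcompidl dcompidr => E.
apply: (@unit_mulI _ (dalpha f did g)); rewrite -E; ring.
Qed.

Lemma depsK f g : uval (deps e f g) * deps e g f = 1.
Proof. by rewrite -(deps_inv e f g) uvalK. Qed.

(** The looper identity at (g, Id, Id) reads alpha(g, Id, Id) alpha(Id, Id, g) eps(g, Id) eps(Id,
    g)^2 = 1, where eps(Id, g) is inverse to eps(g, Id). *)
Lemma deps_g1 g : uval (deps e g did) = dalpha g did did * dalpha did did g.
Proof.
have := deps_loop e g did did; rewrite !dcompidl dcompidr dalpha_1g1 mul1r => E.
rewrite -[LHS]mulr1 -E.
transitivity (dalpha g did did * dalpha did did g *
  ((deps e g did * deps e did g) * (deps e g did * deps e did g))).
  by ring.
by rewrite depsK !mulr1.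
Qed.

End Constraints.

(** * The derivation on HH_1 and the exchange law *)

Section HH1Derivation.
Context {k : comPzRingType} {C : grading_category k} {e : looper C}.
Context {X : obj C} {M : comm_submonoid X}.
Variables (A : comm_graded_algebra e M) (hL : rhoL_descends A).
Local Notation N := (HH1_module hL).

Let clZ := lin_Z (@HH1_class_linear _ _ _ _ _ A).
Let clD := lin_D (@HH1_class_linear _ _ _ _ _ A).

Lemma HH1_class_b2 u : HH1_class (hoch_b2 A u) = 0.
Proof.
rewrite -(lin_0 (@HH1_class_linear _ _ _ _ _ A)).
by apply/HH1_class_eq; exists u; rewrite subr0.
Qed.

(* The unit acts on degree [g] by [lunit g], so this normalisation makes
   [lact a (HH1_d b)] the class of [a \ox b]. *)
Definition HH1_d_homog (g : deg M) (b : A) : N :=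
  dalpha did did g *: HH1_class (gone A \ox b).

Lemma HH1_d_homog_linear g : linear (HH1_d_homog g).
Proof.
apply: linear_scale.
exact: linear_comp (purer_lin _) (@HH1_class_linear _ _ _ _ _ A).
Qed.

Definition HH1_d : A -> N := hext HH1_d_homog.

Lemma HH1_d_linear : linear HH1_d.
Proof. exact/hext_linear/HH1_d_homog_linear. Qed.

Lemma HH1_dE g (b : A) : homog g b ->
  HH1_d b = dalpha did did g *: (HH1_class (gone A \ox b) : N).
Proof. by move=> hb; rewrite /HH1_d (hext_homog HH1_d_homog_linear hb). Qed.

Lemma HH1_d_degree g (b : A) : homog g b -> homog g (HH1_d b).
Proof.
move=> hb; rewrite (HH1_dE hb); apply: homogZ.
exists (gone A \ox b) => //.
by apply: tens_homog_pure (gone_homog A) hb _; rewrite dcompidr.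
Qed.

(** In homogeneous degrees the normalisation of [HH1_d], the constraint [runit f] from
    [gmu a (gone A)] and the inverse associator in [rhoL] multiply to 1 by [dalpha_f1g]. *)
Lemma lact_HH1_d (a b : A) : lact (a : A) (HH1_d b) = HH1_class (a \ox b) :> N.
Proof.
elim/homog_ind: b => [|b b' IH IH'|g b hb].
- rewrite (lin_0 HH1_d_linear) (lin_0 (lact_linear_r _)).
  by rewrite (lin_0 (purer_lin _)) (lin_0 (@HH1_class_linear _ _ _ _ _ A)).
- rewrite (lin_D HH1_d_linear) (lin_D (lact_linear_r _)) IH IH'.
  by rewrite (lin_D (purer_lin _)) clD.
elim/homog_ind: a => [|a a' IH IH'|f a ha].
- rewrite (lin_0 (lact_linear_l _)).
  by rewrite (lin_0 (purel_lin _)) (lin_0 (@HH1_class_linear _ _ _ _ _ A)).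
- rewrite (lin_D (lact_linear_l _)) IH IH'.
  by rewrite (lin_D (purel_lin _)) clD.
rewrite (HH1_dE hb) (lin_Z (lact_linear_r _)) [lact _ _](HH1_actE hL).
rewrite (rhoLE ha (gone_homog A) hb) (gmu_1r ha) (lin_Z (purel_lin _)).
rewrite !clZ !scalerA -[RHS]scale1r; congr (_ *: _).
by rewrite mulrCA [X in _ * X]mulrC /runit -dalpha_f1g mulrC uvalK.
Qed.

(** A Hochschild boundary has class zero. Reassociating (b c) and (c a) style coefficients through
    the left action, the first term gains [dalpha f g h] and the last gains [dalpha h f g], which
    cancels the inverse in b_2. *)
Lemma HH1_d_b2 f g h (a b c : A) : homog f a -> homog g b -> homog h c ->
  dalpha f g h *: lact a (HH1_d (gmu b c)) =
  dalpha f g h *: lact a (lact b (HH1_d c))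
  + deps e (dcomp g f) h *: lact c (lact a (HH1_d b)) :> N.
Proof.
move=> ha hb hc; have := HH1_class_b2 ((a \ox b) \ox c).
rewrite (hoch_b2E ha hb hc) !clD -scaleNr !clZ scaleNr -!lact_HH1_d.
rewrite (lact_assoc ha hb (HH1_d_degree hc)) (lact_assoc hc ha (HH1_d_degree hb)).
rewrite scalerA -mulrA [uinv _ * _]mulrC uvalK mulr1 addrAC => /eqP.
by rewrite subr_eq0 => /eqP <-.
Qed.

(** The boundary relation of the triple (1, a, b), once the action of the unit is removed from each
    term. *)
Lemma HH1_d_mul f g (a b : A) : homog f a -> homog g b ->
  HH1_d (gmu a b) = lact a (HH1_d b) + deps e f g *: lact b (HH1_d a) :> N.
Proof.
move=> ha hb; have := HH1_d_b2 (gone_homog A) ha hb.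
have l1 h (n : N) : homog h n -> dalpha did did h *: lact (gone A) n = n.
  by move=> hn; rewrite (lact_1 hn) scalerA uvalK scale1r.
(* This factor turns the coefficient alpha(Id, f, g) into alpha(Id, Id, g f), which undoes the
   action of 1 in degree g f; in the last term it undoes the action of 1 in degree f. *)
move=> /(congr1 ( *:%R (uval (dalpha did did f)))).
rewrite scalerDr !scalerA dalpha_1fg.
rewrite (l1 _ _ (HH1_d_degree (gmu_homog ha hb))) dcompidr.
have hab : homog (dcomp g f) (lact a (HH1_d b)).
  exact: lact_homog ha (HH1_d_degree hb).
rewrite (l1 _ _ hab) => ->; congr (_ + _).
by rewrite mulrC -scalerA -(lin_Z (lact_linear_r b)) (l1 _ _ (HH1_d_degree ha)).
Qed.

(** Expanding d(b c) by the Leibniz rule in [HH1_d_b2] produces a (b dc) on both sides; the exchange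
    law is what remains after cancelling it. *)
Lemma HH1_exchange_d f g h (a b c : A) : homog f a -> homog g b -> homog h c ->
  (dalpha f g h * deps e g h) *: lact a (lact c (HH1_d b)) =
  deps e (dcomp g f) h *: lact c (lact a (HH1_d b)) :> N.
Proof.
move=> ha hb hc; have := HH1_d_b2 ha hb hc.
rewrite (HH1_d_mul hb hc) (lin_D (lact_linear_r a)) scalerDr => /addrI <-.
by rewrite (lin_Z (lact_linear_r a)) scalerA.
Qed.

(** A homogeneous class is represented by a sum of pure tensors of the same total degree, so
    identities pass from d b to all homogeneous n. *)
Lemma HH1_homog_ind g (P : N -> Prop) :
  P 0 -> (forall x y, P x -> P y -> P (x + y)) ->
  (forall f h (a b : A), homog f a -> homog h b -> dcomp h f = g ->
     P (lact a (HH1_d b))) ->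
  forall n : N, homog g n -> P n.
Proof.
move=> P0 PD Ph n [t ht ->]; elim: ht => [|f h a b {}t ha hb hh _ IH].
  by rewrite (lin_0 (@HH1_class_linear _ _ _ _ _ A)).
by rewrite clD -lact_HH1_d; apply: PD => //; apply: Ph ha hb hh.
Qed.

(** For n = y . d b, compare the exchange law on d b for the scalars a y and c with the one for y
    and c; the associators agree by the pentagon at (f, p, q, h). *)
Lemma HH1_exchange f g h (a c : A) (n : N) :
  homog f a -> homog g n -> homog h c ->
  (dalpha f g h * deps e g h) *: lact a (lact c n) =
  deps e (dcomp g f) h *: lact c (lact a n) :> N.
Proof.
move=> ha hn hc; move: n hn; 
apply: HH1_homog_ind => [|n n' IH IH'|p q y b hy hb <-].
- by rewrite !(lin_0 (lact_linear_r _)) !scaler0.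
- by rewrite !(lin_D (lact_linear_r _)) !scalerDr IH IH'.
(* Commutativity of the monoid gives this degree the form in which it enters the pentagon. *)
have hcb : homog (dcomp h q) (lact c (HH1_d b) : N).
  by rewrite dcompC; apply: lact_homog hc (HH1_d_degree hb).
apply: (@unit_scaleI _ (dalpha f p q)).
have := HH1_exchange_d (gmu_homog ha hy) hb hc.
rewrite (lact_assoc ha hy hcb) (lact_assoc ha hy (HH1_d_degree hb)).
rewrite (lin_Z (lact_linear_r c)) dcompA => E.
rewrite [RHS]scalerA [in RHS]mulrC -[RHS]scalerA -E.
rewrite -[in LHS]scalerA -(lin_Z (lact_linear_r a)).
rewrite -(HH1_exchange_d hy hb hc) (lin_Z (lact_linear_r a)) !scalerA.
by congr (_ *: _); rewrite mulrA dalpha_pentagon; ring.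
Qed.

(** * The right action on HH_1 *)

Definition HH1_ract : N -> A -> N :=
  hext2 (fun (f g : deg M) (n : N) (b : A) => deps e f g *: lact b n).

Let ract_l (f g : deg M) (b : A) : linear (fun n : N => deps e f g *: lact b n).
Proof. exact/linear_scale/lact_linear_r. Qed.

Let ract_r (f g : deg M) (n : N) : linear (fun b : A => deps e f g *: lact b n).
Proof. exact/linear_scale/lact_linear_l. Qed.

Lemma HH1_ract_linear_l b : linear (HH1_ract^~ b).
Proof. exact: hext2_linear_l. Qed.

Lemma HH1_ract_linear_r n : linear (HH1_ract n).
Proof. exact: hext2_linear_r. Qed.

Lemma HH1_ractE f g (n : N) (b : A) : homog f n -> homog g b ->
  HH1_ract n b = deps e f g *: lact b n.
Proof. exact: hext2_homog. Qed.

Lemma HH1_ract_homog f g (n : N) (b : A) : homog f n -> homog g b ->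
  homog (dcomp g f) (HH1_ract n b).
Proof.
move=> hn hb; rewrite (HH1_ractE hn hb) dcompC.
exact/homogZ/lact_homog.
Qed.

(** This is the exchange law, with eps absorbed into the right action. *)
Lemma HH1_lract_assoc f g h (a : A) (n : N) (b : A) :
  homog f a -> homog g n -> homog h b ->
  HH1_ract (lact a n) b = dalpha f g h *: lact a (HH1_ract n b).
Proof.
move=> ha hn hb; rewrite (HH1_ractE hn hb) (HH1_ractE (lact_homog ha hn) hb).
by rewrite -(HH1_exchange ha hn hb) (lin_Z (lact_linear_r a)) scalerA.
Qed.

(** Apply d to (z b) b' = alpha(f, g, h) z (b b') and expand by Leibniz. The terms in d b' agree by
    associativity of the left action, those in d b by the exchange law; those in d z are the
    claim. *)
Lemma HH1_ract_assoc_d f g h (z b b' : A) :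
  homog f z -> homog g b -> homog h b' ->
  HH1_ract (HH1_ract (HH1_d z) b) b'
  = dalpha f g h *: HH1_ract (HH1_d z) (gmu b b').
Proof.
move=> hz hb hb'; have hd := HH1_d_degree hz.
rewrite (HH1_ractE (HH1_ract_homog hd hb) hb').
rewrite (HH1_ractE hd hb) (HH1_ractE hd (gmu_homog hb hb')).
have := congr1 HH1_d (gmu_assoc hz hb hb').
rewrite (lin_Z HH1_d_linear) (HH1_d_mul (gmu_homog hz hb) hb').
rewrite (HH1_d_mul hz (gmu_homog hb hb')) (HH1_d_mul hz hb) (HH1_d_mul hb hb').
rewrite !(lin_D (lact_linear_r _)) !scalerDr.
rewrite (lact_assoc hz hb (HH1_d_degree hb')) -!addrA => /addrI.
rewrite (lin_Z (lact_linear_r z)) scalerA (HH1_exchange_d hz hb hb').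
by move/addrI.
Qed.

(** For n = y . d z, the mixed associativity pulls y out of both sides, which reduces to d z up to
    the pentagon at (p, q, g, h). *)
Lemma HH1_ract_assoc f g h (n : N) (b b' : A) :
  homog f n -> homog g b -> homog h b' ->
  HH1_ract (HH1_ract n b) b' = dalpha f g h *: HH1_ract n (gmu b b').
Proof.
move=> hn hb hb'; move: n hn.
apply: HH1_homog_ind => [|n n' IH IH'|p q y z hy hz <-].
- by rewrite !(lin_0 (HH1_ract_linear_l _)) scaler0.
- by rewrite !(lin_D (HH1_ract_linear_l _)) scalerDr IH IH'.
have hd := HH1_d_degree hz; have hbb := gmu_homog hb hb'.
apply: (@unit_scaleI _ (dalpha p q (dcomp h g))).
rewrite (HH1_lract_assoc hy hd hb) (HH1_lract_assoc hy hd hbb).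
rewrite (lin_Z (HH1_ract_linear_l b')).
rewrite (HH1_lract_assoc hy (HH1_ract_homog hd hb) hb').
rewrite (HH1_ract_assoc_d hz hb hb') (lin_Z (lact_linear_r y)) !scalerA.
congr (_ *: _); rewrite -!mulrA [_ * (_ * dalpha q g h)]mulrA dalpha_pentagon.
by ring.
Qed.

(** By [deps_g1], eps(g, Id) is R(g, Id) divided by L(Id, g), the scalar by which 1 acts on the
    left. *)
Lemma HH1_ract_1 g (n : N) : homog g n -> HH1_ract n (gone A) = runit g *: n.
Proof.
move=> hn; rewrite (HH1_ractE hn (gone_homog A)) (lact_1 hn) scalerA deps_g1.
by rewrite -mulrA uvalK mulr1.
Qed.

Definition HH1_bimodule : graded_bimodule A :=
  @GradedBimodule _ _ _ _ _ A N HH1_ract HH1_ract_linear_l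
    HH1_ract_linear_r HH1_ract_homog HH1_ract_assoc HH1_lract_assoc HH1_ract_1.

Lemma HH1_d_leibniz (a b : A) :
  HH1_d (gmu a b) = lact a (HH1_d b) + HH1_ract (HH1_d a) b.
Proof.
elim/homog_ind: a => [|a a' IH IH'|f a ha].
- rewrite (lin_0 (gmul_lin b)) (lin_0 HH1_d_linear) (lin_0 (lact_linear_l _)).
  by rewrite (lin_0 (HH1_ract_linear_l b)) addr0.
- rewrite (lin_D (gmul_lin b)) !(lin_D HH1_d_linear) (lin_D (lact_linear_l _)).
  by rewrite (lin_D (HH1_ract_linear_l b)) IH IH' addrACA.
elim/homog_ind: b => [|b b' IH IH'|g b hb].
- rewrite (lin_0 (gmur_lin a)) (lin_0 HH1_d_linear) (lin_0 (lact_linear_r a)).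
  by rewrite (lin_0 (HH1_ract_linear_r _)) addr0.
- rewrite (lin_D (gmur_lin a)) !(lin_D HH1_d_linear) (lin_D (lact_linear_r a)).
  by rewrite (lin_D (HH1_ract_linear_r _)) IH IH' addrACA.
by rewrite (HH1_d_mul ha hb) (HH1_ractE (HH1_d_degree ha) hb).
Qed.

End HH1Derivation.

(** * Symmetric bimodules and derivations *)

Section SymmetricBimodules.
Context {k : comPzRingType} {C : grading_category k} {e : looper C}.
Context {X : obj C} {M : comm_submonoid X}.
Variable A : comm_graded_algebra e M.

Definition symmetric_bimodule (N : graded_bimodule A) : Prop :=
  forall f g (n : N) (b : A), homog f n -> homog g b ->
  ract n b = deps e f g *: lact b n.

Definition graded_derivation (N : graded_bimodule A) (D : A -> N) : Prop :=
  [/\ linear D, forall g (a : A), homog g a -> homog g (D a)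
    & forall a b : A, D (gmu a b) = lact a (D b) + ract (D a) b].

(** In a symmetric bimodule the left action and the degrees determine the right action. *)
Lemma lact_morph_ract (N N' : graded_bimodule A) (F : N -> N') :
  symmetric_bimodule N -> symmetric_bimodule N' -> linear F ->
  (forall g n, homog g n -> homog g (F n)) ->
  (forall a n, F (lact a n) = lact a (F n)) ->
  forall n b, F (ract n b) = ract (F n) b.
Proof.
move=> sN sN' Fl Fh Fa n b; elim/homog_ind: n => [|n n' IH IH'|f n hn].
- by rewrite !(lin_0 (ract_linear_l _), lin_0 Fl).
- rewrite (lin_D (ract_linear_l _)) !(lin_D Fl) IH IH'.
  by rewrite (lin_D (ract_linear_l _)).
elim/homog_ind: b => [|b b' IH IH'|g b hb].
- by rewrite !(lin_0 (ract_linear_r _)) (lin_0 Fl).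
- by rewrite !(lin_D (ract_linear_r _)) (lin_D Fl) IH IH'.
by rewrite (sN _ _ _ _ hn hb) (sN' _ _ _ _ (Fh _ _ hn) hb) (lin_Z Fl) Fa.
Qed.

Lemma HH1_bimodule_symmetric (hL : rhoL_descends A) :
  symmetric_bimodule (HH1_bimodule hL).
Proof. exact: HH1_ractE. Qed.

Lemma HH1_d_derivation (hL : rhoL_descends A) :
  @graded_derivation (HH1_bimodule hL) (HH1_d hL).
Proof.
split; [exact: HH1_d_linear | exact: HH1_d_degree | exact: HH1_d_leibniz].
Qed.

Lemma Omega1_symmetric : symmetric_bimodule (Omega1 A).
Proof.
move=> f g _ b [x hx ->] hb; rewrite [ract _ _]kd_ractE [lact _ _]kd_lactE.
by rewrite -kd_classZ; apply/kd_classP/kd_symm.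
Qed.

Definition Omega1_d (a : A) : Omega1 A := kd_diff a.

Lemma Omega1_d_derivation : graded_derivation Omega1_d.
Proof.
split=> [|g a ha|a b]; first exact: kd_diff_linear.
  by exists (kd_d a) => //; apply: kdh_d.
rewrite [lact _ _]kd_lactE [ract _ _]kd_ractE -kd_classD.
exact/kd_classP/kd_leibniz.
Qed.

(** * Maps out of Omega^1 and HH_1 induced by a derivation *)

Section Lifts.
Variables (N : graded_bimodule A) (D : A -> N).
Hypotheses (sN : symmetric_bimodule N) (dD : graded_derivation D).

Let D_linear : linear D. Proof. by case: dD. Qed.
Let D_homog g (a : A) : homog g a -> homog g (D a). Proof. by case: dD g a. Qed.
Let D_leibniz (a b : A) : D (gmu a b) = lact a (D b) + ract (D a) b.
Proof. by case: dD. Qed.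

Fixpoint kd_eval (x : kd_expr A) : N :=
  match x with
  | kd_zero => 0
  | kd_add x y => kd_eval x + kd_eval y
  | kd_scale c x => c *: kd_eval x
  | kd_d a => D a
  | kd_l a x => lact a (kd_eval x)
  | kd_r x b => ract (kd_eval x) b
  end.

(** Several relations of [kd_eq] concern syntactically homogeneous expressions; this gives the
    homogeneity in N that the matching axioms require. *)
Lemma kd_eval_homog g x : kd_homog g x -> homog g (kd_eval x).
Proof.
elim=> {g x} /= *; [exact: homog0 | exact: homogD | exact: homogZ
  | exact: D_homog | exact: lact_homog | exact: ract_homog].
Qed.

(** Each relation becomes a module or bimodule axiom of N, a property of the derivation, or the
    symmetry of N. *)
Lemma kd_eval_eq x y : kd_eq x y -> kd_eval x = kd_eval y.
Proof.
elim=> {x y} //=.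
- by move=> x y z _ -> _ ->.
- by move=> x x' y y' _ -> _ ->.
- by move=> c x x' _ ->.
- by move=> a x x' _ ->.
- by move=> b x x' _ ->.
- by move=> *; rewrite addrA.
- by move=> *; rewrite addrC.
- by move=> *; rewrite add0r.
- by move=> *; rewrite scaleN1r addNr.
- by move=> *; rewrite scalerA.
- by move=> *; rewrite scale1r.
- by move=> *; rewrite scalerDr.
- by move=> *; rewrite scalerDl.
- by move=> a a' x; apply: (lin_D (lact_linear_l _)).
- by move=> s a x; apply: (lin_Z (lact_linear_l _)).
- by move=> a x y; apply: (lin_D (lact_linear_r _)).
- by move=> s a x; apply: (lin_Z (lact_linear_r _)).
- by move=> x y b; apply: (lin_D (ract_linear_l _)).
- by move=> s x b; apply: (lin_Z (ract_linear_l _)).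
- by move=> x b b'; apply: (lin_D (ract_linear_r _)).
- by move=> s x b; apply: (lin_Z (ract_linear_r _)).
- by move=> f g h a a' x ha ha' /kd_eval_homog hx; apply: lact_assoc.
- by move=> g x /kd_eval_homog hx; apply: lact_1.
- by move=> f g h x b b' /kd_eval_homog hx hb hb'; apply: ract_assoc.
- by move=> f g h a x b ha /kd_eval_homog hx hb; apply: lract_assoc.
- by move=> g x /kd_eval_homog hx; apply: ract_1.
- exact: lin_D.
- exact: lin_Z.
by move=> f g x b /kd_eval_homog hx hb; apply: sN.
Qed.

Definition Omega1_lift (z : Omega1 A) : N := kd_eval (@ms_repr k (kd_setoid A) z).

Lemma Omega1_liftE x : Omega1_lift (kd_class x) = kd_eval x.
Proof. exact/kd_eval_eq/kd_repr_class. Qed.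

Definition HH1_eval (t : tens A A) : N := tens_lift (fun a b : A => lact a (D b)) t.

Let eval_bilin : bilin (fun a b : A => lact a (D b) : N).
Proof.
by split=> ?; [exact: lact_linear_l | exact: linear_comp (lact_linear_r _)].
Qed.

Lemma HH1_eval_pure (a b : A) : HH1_eval (a \ox b) = lact a (D b).
Proof. exact: tens_liftE. Qed.

Lemma HH1_eval_linear : linear HH1_eval.
Proof. exact: tens_lift_linear. Qed.

(** Leibniz splits the middle term of b_2: a (b Dc) cancels (a b) Dc, and a (Db c) is, up to its
    associator, (a Db) c, which symmetry turns into the third term. *)
Lemma HH1_eval_b2 u : HH1_eval (hoch_b2 A u) = 0.
Proof.
elim/(@tens3_hind _ _ _ _ _ A): u => [|x y IH IH'|f g h a b c ha hb hc].
- by rewrite linear0 (lin_0 HH1_eval_linear).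
- by rewrite linearD (lin_D HH1_eval_linear) IH IH' addr0.
rewrite (hoch_b2E ha hb hc) -scaleNr !(lin_D HH1_eval_linear).
rewrite !(lin_Z HH1_eval_linear) !HH1_eval_pure D_leibniz.
have [hDb hDc] := (D_homog hb, D_homog hc).
rewrite (lin_D (lact_linear_r a)) (lact_assoc ha hb hDc) (lact_assoc hc ha hDb).
rewrite scalerDr addrA scaleNr subrr add0r scaleNr -(lract_assoc ha hDb hc).
rewrite (sN (lact_homog ha hDb) hc) !scalerA -mulrA.
by rewrite [uinv _ * _]mulrC uvalK mulr1 addNr.
Qed.

Lemma HH1_eval_homog g t : tens_homog g t -> homog g (HH1_eval t).
Proof.
elim=> [|f h a b {}t ha hb <- _ IH].
  by rewrite (lin_0 HH1_eval_linear); apply: homog0.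
rewrite (lin_D HH1_eval_linear) HH1_eval_pure; apply: homogD IH.
exact: lact_homog ha (D_homog hb).
Qed.

Lemma HH1_eval_rhoL (x : A) t : HH1_eval (rhoL x t) = lact x (HH1_eval t).
Proof.
elim/(@tens_hind _ _ _ _ _ A): t => [|t t' IH IH'|g h a b ha hb].
- by rewrite linear0 (lin_0 HH1_eval_linear) (lin_0 (lact_linear_r x)).
- by rewrite linearD !(lin_D HH1_eval_linear) (lin_D (lact_linear_r x)) IH IH'.
elim/homog_ind: x => [|x x' IH IH'|f x hx].
- rewrite (lin_0 (rhoL_linear_l _)) (lin_0 HH1_eval_linear).
  by rewrite (lin_0 (lact_linear_l _)).
- rewrite (lin_D (rhoL_linear_l _)) (lin_D HH1_eval_linear) IH IH'.
  by rewrite (lin_D (lact_linear_l _)).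
rewrite (rhoLE hx ha hb) (lin_Z HH1_eval_linear) !HH1_eval_pure.
by rewrite (lact_assoc hx ha (D_homog hb)) unit_scaleK.
Qed.

Definition HH1_lift (z : HH1 A) : N := HH1_eval (cycle_val (ms_repr z)).

Lemma HH1_liftE t : HH1_lift (HH1_class t) = HH1_eval t.
Proof.
have [u hu] := @ms_repr_class _ (homology_setoid (hoch_b2 A) (hoch_b1 A))
  (Cycle (hoch_b1_0 t)).
(* The difference of the two values is brought to the form -1 x + y, so that linearity makes it one
   value, taken at a boundary. *)
apply/eqP; rewrite -subr_eq0 -scaleN1r addrC -HH1_eval_linear scaleN1r addrC.
by apply/eqP; rewrite [X in HH1_eval X]hu HH1_eval_b2.
Qed.

Lemma HH1_lift_linear : linear HH1_lift.
Proof.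
move=> c; apply: HH1_ind => t; apply: HH1_ind => t'.
by rewrite -HH1_class_linear !HH1_liftE HH1_eval_linear.
Qed.

End Lifts.

(** Uniqueness in the universal property: the elements d a generate Omega^1 under the two
    actions. *)
Lemma Omega1_endo_id (F : Omega1 A -> Omega1 A) : linear F ->
  (forall a z, F (lact a z) = lact a (F z)) ->
  (forall z b, F (ract z b) = ract (F z) b) ->
  (forall a, F (Omega1_d a) = Omega1_d a) -> F =1 id.
Proof.
move=> Fl Fa Fr Fd; apply: kd_mod_ind.
elim=> [|x IHx y IHy|c x IH|a|a x IH|x IH b].
- exact: (lin_0 Fl).
- by rewrite kd_classD (lin_D Fl) IHx IHy.
- by rewrite kd_classZ (lin_Z Fl) IH.
- exact: Fd.
- by have := Fa a (kd_class x); rewrite IH [lact _ _]kd_lactE.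
by have := Fr (kd_class x) b; rewrite IH [ract _ _]kd_ractE.
Qed.

End SymmetricBimodules.

(** * The two lifts are mutually inverse *)

Theorem proposition3p12 (k : comPzRingType) (C : grading_category k)
    (e : looper C) (X : obj C) (M : comm_submonoid X)
    (A : comm_graded_algebra e M) (hL : rhoL_descends A) :
  graded_module_iso (HH1_module hL) (Omega1 A).
Proof.
have sH := HH1_bimodule_symmetric (hL := hL); have dH := HH1_d_derivation hL.
have sO := @Omega1_symmetric _ _ _ _ _ A.
have dO := @Omega1_d_derivation _ _ _ _ _ A.
have cl_lin := @HH1_class_linear _ _ _ _ _ A.
have [d_lin d_homog _] := dO.
pose phi : HH1_bimodule hL -> Omega1 A := HH1_lift (@Omega1_d _ _ _ _ _ A).
pose psi : Omega1 A -> HH1_bimodule hL :=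
  Omega1_lift (N := HH1_bimodule hL) (HH1_d hL).
have phi_lin : linear phi by apply: HH1_lift_linear.
have phiE (a b : A) : phi (HH1_class (a \ox b)) = lact a (Omega1_d b).
  by rewrite /phi HH1_liftE // HH1_eval_pure.
have psiE x : psi (kd_class x) = kd_eval (N := HH1_bimodule hL) (HH1_d hL) x.
  exact: Omega1_liftE.
have phi_homog g n : homog g n -> homog g (phi n).
  by move=> [t ht ->]; rewrite /phi HH1_liftE //; apply: HH1_eval_homog.
have phi_lact a n : phi (lact a n) = lact a (phi n).
  move: n; apply: HH1_ind => t.
  by rewrite [lact a _](HH1_actE hL) /phi !HH1_liftE // HH1_eval_rhoL.
have phi_d b : phi (HH1_d hL b) = Omega1_d b.
  elim/homog_ind: b => [|b b' IH IH'|g b hb].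
  - by rewrite (lin_0 (HH1_d_linear _)) (lin_0 phi_lin) (lin_0 d_lin).
  - by rewrite (lin_D (HH1_d_linear _)) (lin_D phi_lin) IH IH' (lin_D d_lin).
  rewrite (HH1_dE hL hb) (lin_Z phi_lin) phiE.
  (* The normalisation of [HH1_d] is inverse to the action of 1 in degree g. *)
  by rewrite (lact_1 (d_homog _ _ hb)) scalerA uvalK scale1r.
have psi_lin : linear psi.
  move=> c; apply: kd_mod_ind => x; apply: kd_mod_ind => y.
  by rewrite -kd_classZ -kd_classD !psiE.
have psi_lact a z : psi (lact a z) = lact a (psi z).
  by move: z; apply: kd_mod_ind => x; rewrite [lact a _]kd_lactE !psiE.
have psi_ract z b : psi (ract z b) = ract (psi z) b.
  by move: z; apply: kd_mod_ind => x; rewrite [ract _ b]kd_ractE !psiE.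
have psi_d b : psi (Omega1_d b) = HH1_d hL b by rewrite psiE.
have phiK : cancel phi psi.
  apply: HH1_ind; elim/(@tens_hind _ _ _ _ _ A) => [|t t' IH IH'|f g a b _ _].
  - by rewrite (lin_0 cl_lin) (lin_0 phi_lin) (lin_0 psi_lin).
  - by rewrite (lin_D cl_lin) (lin_D phi_lin) (lin_D psi_lin) IH IH'.
  by rewrite phiE psi_lact psi_d (lact_HH1_d hL).
(* The composite is a bimodule endomorphism fixing every d a; [phi] respects the right action
   because both bimodules are symmetric. *)
have psiK : cancel psi phi.
  apply: (@Omega1_endo_id _ _ _ _ _ A (phi \o psi)) => /=.
  - exact: linear_comp.
  - by move=> a z; rewrite psi_lact phi_lact.
  - by move=> z b; rewrite psi_ract (lact_morph_ract sH sO).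
  by move=> a; rewrite psi_d phi_d.
pose phiL := GRing.isLinear.Build k _ _ *:%R phi phi_lin.
pose phi' : {linear HH1_module hL -> Omega1 A} := HB.pack phi phiL.
by exists phi'; split=> //; exists psi.
Qed.
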